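(* Let $G$ be a planar graph. Then $G$ is a median graph if and only if all of the following hold: (1) $G$ is connected; (2) $G$ is $K_{2,3}$-free; (3) $G$ is $C_6^{\mathrm{iso}}$-$Q_3$-inferring, i.e., for each isometric cycle $C_6$ of length $6$ in $G$ there is a cube $Q_3\subseteq G$ such that $C_6\subseteq Q_3$; (4) every isometric cycle in $G$ has length $4$ or $6$.
   Context: All graphs are finite, undirected and simple. $H\subseteq G$ means that $H$ is a (not necessarily induced) subgraph of $G$. A graph is $H$-free if it has no (not necessarily induced) subgraph isomorphic to $H$. $d_G(v,w)$ is the length of a shortest path between $v$ and $w$ in $G$. A subgraph $G'\subseteq G$ is isometric if $d_{G'}(v,w)=d_G(v,w)$ for all $v,w\in V(G')$. A cube $Q_3$ is a graph isomorphic to the $3$-dimensional hypercube $K_2\Box K_2\Box K_2$. A vertex $x$ is a median of $u,v,w\in V(G)$ if $d_G(u,x)+d_G(x,v)=d_G(u,v)$, $d_G(v,x)+d_G(x,w)=d_G(v,w)$ and $d_G(u,x)+d_G(x,w)=d_G(u,w)$. A connected graph is a median graph if every triple of its vertices has a unique median. *)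

(* Defs.v *)
From HB Require Import structures.
From mathcomp Require Import all_boot all_order all_algebra.
From mathcomp Require Import all_classical all_reals topology normedtype.
Set Implicit Arguments.
Unset Strict Implicit.
Unset Printing Implicit Defensive.
Import Order.TTheory GRing.Theory Num.Theory.
Import numFieldNormedType.Exports.

Record sgraph := SGraph {
  vertex :> finType;
  edge : rel vertex;
  edge_sym : symmetric edge;
  edge_irrefl : irreflexive edge }.

Arguments edge {s}.

Section CompleteGraph.
Variable n : nat.

Definition complete_rel : rel 'I_n := fun i j => i != j.

Lemma complete_sym : symmetric complete_rel.
Proof. by move=> i j; rewrite /complete_rel eq_sym. Qed.

Lemma complete_irrefl : irreflexive complete_rel.
Proof. by move=> i; rewrite /complete_rel eqxx. Qed.

Definition complete_graph := SGraph complete_sym complete_irrefl.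
End CompleteGraph.

Section CompleteBipartiteGraph.
Variables m n : nat.

Definition complete_bipartite_rel : rel ('I_m + 'I_n) :=
  fun a b => match a, b with
             | inl _, inr _ | inr _, inl _ => true
             | _, _ => false
             end.

Lemma complete_bipartite_sym : symmetric complete_bipartite_rel.
Proof. by case=> ? []. Qed.

Lemma complete_bipartite_irrefl : irreflexive complete_bipartite_rel.
Proof. by case. Qed.

Definition complete_bipartite_graph : sgraph :=
  SGraph complete_bipartite_sym complete_bipartite_irrefl.
End CompleteBipartiteGraph.

Section CycleGraph.
Variable n : nat.

(* [i != j] only matters for [n = 1]; the graph is a cycle only for [n >= 3]. *)
Definition cycle_rel : rel 'I_n :=
  fun i j => (i != j) && ((ordS i == j) || (ordS j == i)).

Lemma cycle_rel_sym : symmetric cycle_rel.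
Proof. by move=> i j; rewrite /cycle_rel eq_sym orbC. Qed.

Lemma cycle_rel_irrefl : irreflexive cycle_rel.
Proof. by move=> i; rewrite /cycle_rel eqxx. Qed.

Definition cycle_graph := SGraph cycle_rel_sym cycle_rel_irrefl.
End CycleGraph.

Section BoxProduct.
Variables G H : sgraph.

Definition box_rel : rel (G * H) :=
  fun a b => ((a.1 == b.1) && edge a.2 b.2) || (edge a.1 b.1 && (a.2 == b.2)).

Lemma box_sym : symmetric box_rel.
Proof.
by move=> a b; rewrite /box_rel (eq_sym a.1) (eq_sym a.2) (edge_sym a.1) (edge_sym a.2).
Qed.

Lemma box_irrefl : irreflexive box_rel.
Proof. by move=> a; rewrite /box_rel !edge_irrefl andbF. Qed.

Definition box_product : sgraph := SGraph box_sym box_irrefl.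
End BoxProduct.

Definition cube_Q3 : sgraph :=
  box_product (box_product (complete_graph 2) (complete_graph 2))
              (complete_graph 2).

Definition isomorphic (G H : sgraph) : Prop :=
  exists f : G -> H, bijective f /\ {mono f : x y / edge x y}.

Record subgraph (G : sgraph) := Subgraph {
  sub_vertices : {set G};
  sub_edge : rel G;
  sub_edge_sym : symmetric sub_edge;
  sub_edgeP : forall x y, sub_edge x y ->
    [&& x \in sub_vertices, y \in sub_vertices & edge x y] }.

Section SubgraphAsGraph.
Variables (G : sgraph) (H : subgraph G).

Definition sub_rel : rel {x : G | x \in sub_vertices H} :=
  fun x y => sub_edge H (val x) (val y).

Lemma sub_rel_sym : symmetric sub_rel.
Proof. by move=> x y; apply: sub_edge_sym. Qed.

Lemma sub_rel_irrefl : irreflexive sub_rel.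
Proof.
move=> x; apply/negbTE/negP => /sub_edgeP/and3P[_ _].
by rewrite edge_irrefl.
Qed.

Definition graph_of_subgraph : sgraph := SGraph sub_rel_sym sub_rel_irrefl.
End SubgraphAsGraph.

Coercion graph_of_subgraph : subgraph >-> sgraph.

Definition subgraph_le (G : sgraph) (H K : subgraph G) : Prop :=
  sub_vertices H \subset sub_vertices K /\ subrel (sub_edge H) (sub_edge K).

Definition graph_free (H G : sgraph) : Prop :=
  ~ exists K : subgraph G, isomorphic K H.

Definition is_cycle (n : nat) (G : sgraph) : Prop :=
  3 <= n /\ isomorphic G (cycle_graph n).

Definition graph_connected (G : sgraph) : Prop :=
  forall x y : G, connect edge x y.

Definition has_path (G : sgraph) (x y : G) : pred nat := fun n =>
  [exists p : n.-tuple G, [&& path edge x p, uniq (x :: p) & last x p == y]].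

Lemma connect_has_path (G : sgraph) (x y : G) :
  connect edge x y -> exists n, has_path x y n.
Proof.
case/connectP => p0 /shortenP[p pP pU _] ->; exists (size p).
by apply/existsP; exists (in_tuple p); rewrite pP pU eqxx.
Qed.

(* The distance is [0] by convention when [x] and [y] are not connected. As the
   distance of distinct connected vertices is positive, equality of distances
   in [isometric] still agrees with the convention that it be infinite. *)
Definition gdist (G : sgraph) (x y : G) : nat :=
  match boolP (connect edge x y) with
  | AltTrue xy => ex_minn (connect_has_path xy)
  | AltFalse _ => 0
  end.

Definition isometric (G : sgraph) (H : subgraph G) : Prop :=
  forall x y : H, gdist x y = gdist (val x) (val y).

Definition is_median (G : sgraph) (u v w x : G) : Prop :=
  [/\ gdist u x + gdist x v = gdist u v,
      gdist v x + gdist x w = gdist v w &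
      gdist u x + gdist x w = gdist u w].

Definition median_graph (G : sgraph) : Prop :=
  graph_connected G /\ forall u v w : G, exists! x, is_median u v w x.

Definition C6iso_Q3_inferring (G : sgraph) : Prop :=
  forall C : subgraph G, is_cycle 6 C -> isometric C ->
  exists Q : subgraph G, isomorphic Q cube_Q3 /\ subgraph_le C Q.

Section Planar.
Local Open Scope classical_set_scope.
Local Open Scope ring_scope.

(* [arc x y], restricted to [0, 1], is the simple arc drawing the edge [xy],
   oriented from [x] to [y]; [arc y x] is the same arc reversed. *)
Definition is_plane_drawing (R : realType) (G : sgraph)
    (pt : G -> R * R) (arc : G -> G -> R -> R * R) : Prop :=
  [/\ injective pt,
      forall x y, edge x y ->
        [/\ {within `[0, 1], continuous (arc x y)},
            {in `[0, 1] &, injective (arc x y)},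
            arc x y 0 = pt x,
            arc x y 1 = pt y &
            {in `[0, 1], forall t, arc y x t = arc x y (1 - t)}],
      forall x y z, edge x y -> {in `]0, 1[, forall t, arc x y t <> pt z} &
      forall x y u v, edge x y -> edge u v ->
        (u, v) <> (x, y) -> (u, v) <> (y, x) ->
        {in `]0, 1[ &, forall s t, arc x y s <> arc u v t}].

Definition planar (R : realType) (G : sgraph) : Prop :=
  exists (pt : G -> R * R) (arc : G -> G -> R -> R * R),
    is_plane_drawing pt arc.
End Planar.

(* Main.v *)
Require Import Defs.
From mathcomp Require Import all_boot all_order all_algebra.
From mathcomp Require Import all_classical all_reals topology normedtype.
From mathcomp Require Import zify ring lra.

(* Conditions (1)-(4) imply the median property without planarity.  Take a
   counterexample to the quadrangle condition at minimal distance k from its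
   base point: the closed walk formed by the two geodesics has length 2k+2, and
   minimality makes each of its rotations a counterexample too, so its antipodal
   pairs are at distance k+1 and it is an isometric cycle.  By (4) k = 2, and the
   cube given by (3) contains the missing vertex.  Bipartiteness follows in the
   same way.  The quadrangle condition yields medians, K_{2,3}-freeness their
   uniqueness.

   Conversely, in a median graph an isometric cycle of length 2k+2 has an
   isometric cycle of length 2k attached to it by a ladder.  So an isometric
   cycle of length at least 8 produces one of length 8, hence a cube with a path
   outside it joining two antipodal vertices, and this graph contracts to K_5.

   That K_5 minors are not planar is proved by counting crossings mod 2: replace
   each arc by a polygon through nearby points in general position.  Straightening
   a polygon joining x and y changes its crossing number with an edge zw by
   f z + f w, for a function f counting triangles, so the total number of
   crossings of disjoint edges of K_5 keeps its parity, which is odd for five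
   points in the plane. *)

Set Implicit Arguments.
Unset Strict Implicit.
Unset Printing Implicit Defensive.
Import Order.TTheory GRing.Theory Num.Theory.
Import numFieldNormedType.Exports.

(** * Distances *)

Lemma gdist_le_size (G : sgraph) (x : G) p :
  path edge x p -> gdist x (last x p) <= size p.
Proof.
move=> xp; rewrite /gdist; case: {-}_ / boolP => // xy.
case: ex_minnP => m _ m_min.
(* [has_path] admits only walks without repeated vertices, so the walk is shortened first. *)
case/shortenP: xp m_min => p' p'P p'U sub m_min.
apply: (leq_trans (m_min (size p') _)).
  by apply/existsP; exists (in_tuple p'); rewrite p'P p'U eqxx.
by apply: uniq_leq_size => //; case/andP: p'U.
Qed.

Lemma gdist_walk (G : sgraph) (x y : G) : connect edge x y ->
  exists p, [/\ path edge x p, last x p = y & size p = gdist x y].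
Proof.
move=> xy; rewrite /gdist; case: {-}_ / boolP => [xy'|]; last by rewrite xy.
case: ex_minnP => m /existsP[p /and3P[pP _ /eqP <-]] _.
by exists p; rewrite size_tuple.
Qed.

Section Distance.
Variable G : sgraph.
Hypothesis conn : graph_connected G.
Implicit Types (u v w x y z : G) (k i j : nat).

Lemma gdist0 x : gdist x x = 0.
Proof. by apply/eqP; rewrite -leqn0; apply: (@gdist_le_size _ x [::]). Qed.

Lemma gdist_eq0 x y : gdist x y = 0 -> x = y.
Proof. by case: (gdist_walk (conn x y)) => p [_ <- <-] /size0nil ->. Qed.

Lemma gdist_gt0 x y : x != y -> 0 < gdist x y.
Proof. by rewrite lt0n; apply: contra => /eqP/gdist_eq0/eqP. Qed.

Lemma gdist_tri y x z : gdist x z <= gdist x y + gdist y z.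
Proof.
have [p [pP py <-]] := gdist_walk (conn x y).
have [q [qP qz <-]] := gdist_walk (conn y z).
rewrite -size_cat.
have -> : z = last x (p ++ q) by rewrite last_cat py.
by apply: gdist_le_size; rewrite cat_path pP py.
Qed.

Lemma gdistC x y : gdist x y = gdist y x.
Proof.
have le (a b : G) : gdist a b <= gdist b a.
  have [p [pP pb <-]] := gdist_walk (conn b a).
  have lastr : last a (rev (belast b p)) = b.
    by rewrite -pb; case: p {pP pb} => //= c p; rewrite rev_cons last_rcons.
  have pathr : path edge a (rev (belast b p)).
    by rewrite -pb rev_path; apply: sub_path pP => s t; rewrite /= edge_sym.
  by have := gdist_le_size pathr; rewrite lastr size_rev size_belast.
by apply/eqP; rewrite eqn_leq !le.
Qed.

Lemma edge_neq x y : edge x y -> x != y.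
Proof. by move=> e; apply/eqP => E; move: e; rewrite E edge_irrefl. Qed.

Lemma gdist_edge x y : edge x y -> gdist x y = 1.
Proof.
move=> e; apply/eqP; rewrite eqn_leq gdist_gt0 ?edge_neq // andbT.
by apply: (@gdist_le_size _ x [:: y]); rewrite /= e.
Qed.

Lemma gdist_step u x y : edge x y -> gdist u y <= (gdist u x).+1.
Proof. by move=> e; rewrite -addn1 -(gdist_edge e) gdist_tri. Qed.

Lemma gdist_next x y k : gdist x y = k.+1 -> exists2 z, edge x z & gdist z y = k.
Proof.
move=> dk; have [[|z p] [/=]] := gdist_walk (conn x y); rewrite dk //.
case/andP=> xz zp zy [szp]; exists z => //.
apply/eqP; rewrite eqn_leq -{1}zy -{1}szp gdist_le_size //=.
have := gdist_tri z x y; rewrite dk (gdist_edge xz); lia.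
Qed.

Lemma edge_gdist1 x y : gdist x y = 1 -> edge x y.
Proof. by case/gdist_next => z xz /gdist_eq0 <-. Qed.

Lemma geodesic x y : exists c : nat -> G,
  [/\ c 0 = x, c (gdist x y) = y,
      forall i, i < gdist x y -> edge (c i) (c i.+1) &
      forall i j, i <= j <= gdist x y -> gdist (c i) (c j) = j - i].
Proof.
have [p [pP py sp]] := gdist_walk (conn x y).
pose c i := nth x (x :: p) i.
have ce i : i < gdist x y -> edge (c i) (c i.+1).
  by rewrite -sp => ip; apply: (pathP x pP).
have cy : c (gdist x y) = y by rewrite /c -sp -py nth_last.
have le i j : i <= j -> j <= gdist x y -> gdist (c i) (c j) <= j - i.
  elim: j => [|j IHj] ij jd; first by rewrite (eqP (_ : i == 0)) ?gdist0; lia.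
  have [->|ij'] := eqVneq i j.+1; first by rewrite gdist0.
  have := gdist_step (c i) (ce j jd); have := IHj ltac:(lia) ltac:(lia); lia.
exists c; split=> // i j /andP[ij jd].
(* The pieces before [c i] and after [c j] have length at most [i] and [gdist x y - j], so the
   middle piece cannot be shorter than [j - i]. *)
apply/eqP; rewrite eqn_leq le //=.
have := gdist_tri (c i) x y; have := gdist_tri (c j) (c i) y.
have := le 0 i (leq0n _) (leq_trans ij jd); have := le j (gdist x y) jd (leqnn _).
rewrite cy (erefl : c 0 = x); lia.
Qed.

End Distance.

(** * Bipartiteness and the quadrangle condition from isometric cycles *)

(** A cycle as an [n]-periodic sequence, so that rotating it is shifting the index. For [n = 2] this
    is an edge walked back and forth. *)
Definition isocycle (G : sgraph) n (c : nat -> G) :=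
  [/\ forall i, edge (c i) (c i.+1), forall i, c (i + n) = c i &
      forall i, gdist (c i) (c (i + n./2)) = n./2].

Definition quadrangle_condition (G : sgraph) :=
  forall (u z v w : G) k, edge z v -> edge z w ->
    gdist u z = k.+2 -> gdist u v = k.+1 -> gdist u w = k.+1 ->
  exists x, [/\ edge v x, edge w x & gdist u x = k].

Lemma succ_modn i n : i.+1 %% n.+1 = if i %% n.+1 == n then 0 else (i %% n.+1).+1.
Proof.
have := ltn_pmod i (ltn0Sn n); rewrite -[i.+1]addn1 -modnDml addn1; move: (i %% _) => r.
by case: eqP => [-> _|/eqP ne lt]; rewrite ?modnn // modn_small // ltn_neqAle eqSS ne.
Qed.

Section Cycles.
Variable G : sgraph.
Hypothesis conn : graph_connected G.
Implicit Types (u v w x y z : G) (c : nat -> G).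

Lemma gdist_walk_le c : (forall i, edge (c i) (c i.+1)) ->
  forall i j, gdist (c i) (c (i + j)) <= j.
Proof.
move=> ce i; elim=> [|j IHj]; first by rewrite addn0 gdist0.
by rewrite addnS; apply: leq_trans (gdist_step conn _ (ce _)) _.
Qed.

Lemma periodic_mul c n : (forall i, c (i + n) = c i) ->
  forall t i, c (i + t * n) = c i.
Proof. by move=> cP; elim=> [|t IHt] i; rewrite ?addn0 // mulSn addnA IHt. Qed.

(* Antipodal distances suffice: a shorter arc extends to an antipodal one. *)
Lemma isocycle_gdist n c i j : isocycle n c -> j <= n./2 ->
  gdist (c i) (c (i + j)) = j.
Proof.
case=> ce _ cd jn; apply/eqP; rewrite eqn_leq gdist_walk_le //=.
have := gdist_tri conn (c (i + j)) (c i) (c (i + n./2)); rewrite cd.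
have := gdist_walk_le ce (i + j) (n./2 - j).
rewrite (_ : i + j + (n./2 - j) = i + n./2); lia.
Qed.

(** A counterexample with [k] minimal closes two geodesics into a walk of odd length [k.*2.+1].
    Being a counterexample passes from [c i] to [c (i + k)] and, as [k] is prime to the length, to
    every vertex; the walk is then an odd isometric cycle. *)
Lemma even_isocycles_bipartite :
    (forall n c, 3 <= n -> isocycle n c -> ~~ odd n) ->
  forall u x y, edge x y -> gdist u x <> gdist u y.
Proof.
move=> evenC.
suff bip k u x y : edge x y -> gdist u x = k -> gdist u y <> k.
  by move=> u x y xy E; apply: (bip (gdist u y) u x y).
elim/ltn_ind: k u x y => k IH u x y xy dx dy.
have k_gt0 : 0 < k.
  case: k {IH} dx dy => // /(gdist_eq0 conn) ux /(gdist_eq0 conn) uy.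
  by rewrite -ux -uy edge_irrefl in xy.
have [a [a0 ak ae _]] := geodesic conn u x.
have [b [b0 bk be _]] := geodesic conn u y.
rewrite dx in ak ae; rewrite dy in bk be.
pose n := k.*2.+1.
pose c i := if i %% n <= k then a (i %% n) else b (n - i %% n).
have cP i : c (i + n) = c i by rewrite /c modnDr.
have ce i : edge (c i) (c i.+1).
  rewrite /c; have lt_in : i %% n < n by rewrite ltn_mod.
  have -> : i.+1 %% n = if i %% n == k.*2 then 0 else (i %% n).+1.
    by rewrite succ_modn.
  move: (i %% n) lt_in => r; rewrite /n => lt_rn.
  case: eqP => [->|ne].
    rewrite (_ : (k.*2 <= k) = false) ?a0; last lia.
    rewrite (_ : k.*2.+1 - k.*2 = 1); last lia.
    by rewrite edge_sym -b0 be.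
  case: (ltngtP r k) => [lt_rk|gt_rk|->].
  - by rewrite ae.
  - rewrite (_ : k.*2.+1 - r = (k.*2.+1 - r.+1).+1); last lia.
    by rewrite edge_sym be //; lia.
  - by rewrite ak (_ : k.*2.+1 - k.+1 = k) ?bk //; lia.
pose bad i := gdist (c i) (c (i + k)) = k /\ gdist (c i) (c (i + k.+1)) = k.
have bad0 : bad 0.
  rewrite /bad /c !add0n mod0n leq0n a0 !modn_small /n; try lia.
  by rewrite leqnn ltnn ak (_ : k.*2.+1 - k.+1 = k) ?bk //; lia.
(* [c i] sees both ends of the opposite edge at distance [k]; by minimality of
   [k] the vertex [c (i + k)] does too. *)
have badS i : bad i -> bad (i + k).
  case=> d1 d2; split.
    have q1 : gdist (c (i + k.*2)) (c (i + k.+1)) = k.-1.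
      have := gdist_walk_le ce (i + k.+1) k.-1.
      have := gdist_tri conn (c (i + k.*2)) (c i) (c (i + k.+1)).
      have := gdist_edge conn (ce (i + k.*2)).
      rewrite (_ : (i + k.*2).+1 = i + n) ?cP; last by rewrite /n; lia.
      rewrite (_ : i + k.+1 + k.-1 = i + k.*2); last lia.
      rewrite (gdistC conn (c (i + k.*2)) (c i)).
      rewrite (gdistC conn (c (i + k.*2)) (c (i + k.+1))) d2; lia.
    have e := ce (i + k); rewrite -addnS in e.
    have ne : gdist (c (i + k.*2)) (c (i + k)) <> k.-1.
      by move=> E; apply: (IH k.-1 _ (c (i + k.*2)) _ _ e E q1); lia.
    rewrite edge_sym in e.
    have := gdist_step conn (c (i + k.*2)) e; rewrite q1.
    have := gdist_tri conn (c (i + k.*2)) (c i) (c (i + k)).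
    have := gdist_edge conn (ce (i + k.*2)).
    rewrite (_ : (i + k.*2).+1 = i + n) ?cP; last by rewrite /n; lia.
    rewrite (_ : i + k + k = i + k.*2); last lia.
    rewrite (gdistC conn (c (i + k.*2)) (c i)).
    rewrite (gdistC conn (c (i + k)) (c (i + k.*2))) d1; lia.
  by rewrite (_ : i + k + k.+1 = i + n) ?cP 1?gdistC //; rewrite /n; lia.
have badM m : bad (m * k).
  by elim: m => // m IHm; rewrite mulSn addnC; apply: badS.
have cD i : gdist (c i) (c (i + n./2)) = n./2.
  rewrite (_ : n./2 = k); last by rewrite /n; lia.
  (* Modulo [n] one has [2 * k = -1], hence [4 * k * k = 1]: starting at 0, [4 * i * k] steps of
     size [k] lead to [i]. *)
  have sq m : 4 * i * m.+1 * m.+1 = i + i * m.*2.+1 * m.+1.*2.+1 by nia.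
  have E : 4 * i * k * k = i + i * k.-1.*2.+1 * n.
    by have := sq k.-1; rewrite prednK.
  by have [] := badM (4 * i * k); rewrite E addnAC !periodic_mul.
by have := evenC n c _ (And3 ce cP cD); rewrite /n /= odd_double; lia.
Qed.

Section QuadrangleCondition.
Hypothesis bip : forall u x y, edge x y -> gdist u x <> gdist u y.
Hypothesis isocycle46 : forall n c, 3 <= n -> isocycle n c -> n = 4 \/ n = 6.
Hypothesis isocycle6 : forall c, isocycle 6 c ->
  exists m, [/\ edge (c 0) m, edge (c 2) m & edge (c 4) m].

Lemma isocycle_quadrangle_condition : quadrangle_condition G.
Proof.
move=> u z v w k.
elim/ltn_ind: k u z v w => k IH u z v w zv zw dz dv dw.
apply: contrapT => no_x.
have k_gt0 : 0 < k.
  case: k {IH} dz dv dw no_x => // dz dv dw; case; exists u.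
  by rewrite !(edge_sym _ u) !edge_gdist1 // gdist0.
have [a [a0 ak ae _]] := geodesic conn u v.
have [b [b0 bk be _]] := geodesic conn u w.
have [K EK] : exists K, K = k.+1 by exists k.+1.
rewrite dv -EK in ak ae; rewrite dw -EK in bk be.
pose n := K.*2.+2.
pose c i := let r := i %% n in
  if r <= K then a r else if r == K.+1 then z else b (n - r).
have cP i : c (i + n) = c i by rewrite /c modnDr.
have ce i : edge (c i) (c i.+1).
  rewrite /c; have lt_in : i %% n < n by rewrite ltn_mod.
  have -> : i.+1 %% n = if i %% n == K.*2.+1 then 0 else (i %% n).+1.
    by rewrite succ_modn.
  move: (i %% n) lt_in => r; rewrite /n => lt_rn /=.
  case: (r =P K.*2.+1) => [->|ne].
    rewrite (_ : (K.*2.+1 <= K) = false) ?a0; last lia.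
    rewrite (_ : K.*2.+2 - K.*2.+1 = 1); last lia.
    rewrite (_ : (_ == K.+1) = false) /=; last lia.
    by rewrite edge_sym -b0 be // EK.
  case: (ltngtP r K) => [lt_rk|gt_rk|->].
  - by rewrite ae.
  - rewrite eqSS (_ : (r == K) = false); last lia.
    case: eqP => [->|ne'].
      by rewrite (_ : K.*2.+2 - K.+2 = K) ?bk //; lia.
    rewrite (_ : K.*2.+2 - r = (K.*2.+2 - r.+1).+1); last lia.
    by rewrite edge_sym be //; lia.
  - by rewrite eqxx ak edge_sym.
(* A counterexample with base [c i], its antipode as top, and the neighbors of the antipode on the
   cycle as [v] and [w]. That these are at distance [K] from the base follows. *)
pose bad i := gdist (c i) (c (i + K.+1)) = K.+1 /\
  forall y, edge (c (i + K)) y -> edge (c (i + K.+2)) y -> gdist (c i) y <> k.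
have bad0 : bad 0.
  rewrite /bad /c !add0n mod0n leq0n a0 !modn_small /n; try lia.
  rewrite leqnn ltnn eqxx dz ak; split=> [|y vy]; first by rewrite EK.
  rewrite (_ : (K.+2 <= K) = false); last lia.
  rewrite (_ : (K.+2 == K.+1) = false); last lia.
  rewrite (_ : K.*2.+2 - K.+2 = K) ?bk; last lia.
  by move=> wy dy; apply: no_x; exists y.
(* The counterexample based at [c i] rotates to one based at its neighbor
   [c (i + K.+2)] of the antipode, whose top is [c i.+1]. *)
have badS i : bad i -> bad (i + K.+2).
  case=> dT noy; pose V := c (i + K); pose Z := c (i + K.+1); pose W := c (i + K.+2).
  have ZV : edge Z V by have := ce (i + K); rewrite -addnS edge_sym.
  have ZW : edge Z W by have := ce (i + K.+1); rewrite -addnS.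
  have dV : gdist (c i) V = K.
    have := gdist_step conn (c i) (ce (i + K)); rewrite -addnS dT.
    have := gdist_walk_le ce i K; rewrite /V; lia.
  have dW : gdist (c i) W = K.
    have := gdist_walk_le ce (i + K.+2) K.
    rewrite (_ : i + K.+2 + K = i + n) ?cP; last by rewrite /n; lia.
    rewrite gdistC // -/W.
    rewrite edge_sym in ZW; have := gdist_step conn (c i) ZW; rewrite dT; lia.
  (* Here [p] lies on a geodesic from [c i] to [V]. If [W] were as near to [p] as [V] is, minimality
     of [k], applied with base [p], would give a vertex that [noy] excludes. *)
  have far p : 0 < gdist (c i) p -> gdist (c i) p + gdist p V = K ->
      gdist p W <> gdist p V.
    move=> p_gt0 pV pW.
    have pZ : gdist p Z = (gdist p V).+1.
      have := gdist_tri conn p (c i) Z; rewrite dT.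
      rewrite edge_sym in ZV; have := gdist_step conn p ZV; lia.
    case E: (gdist p V) => [|m].
      rewrite E in pW; move: E pW => /(gdist_eq0 conn) -> /(gdist_eq0 conn) VW.
      have [y Vy dy] := gdist_next conn (etrans (gdistC conn V _) (etrans dV EK)).
      by apply: (noy y) => //; rewrite -/W -?VW // gdistC.
    have ltmk : m < k by move: pV p_gt0; rewrite E; lia.
    have [y [Vy Wy dy]] :=
      IH m ltmk p Z V W ZV ZW (etrans pZ (congr1 S E)) E (etrans pW E).
    apply: (noy y) => //.
    have := gdist_tri conn p (c i) y.
    rewrite edge_sym in Vy; have := gdist_step conn (c i) Vy; rewrite dV.
    by move: pV; rewrite E dy; lia.
  have d1 : gdist (c i) (c i.+1) = 1 by rewrite gdist_edge.
  have i1V : gdist (c i.+1) V = k.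
    have := gdist_walk_le ce i.+1 k.
    rewrite (_ : i.+1 + k = i + K); last lia.
    by have := gdist_tri conn (c i.+1) (c i) V; rewrite dV d1 /V; lia.
  split.
    rewrite (_ : i + K.+2 + K.+1 = i.+1 + n) ?cP; last by rewrite /n; lia.
    rewrite gdistC // -/W.
    have ne := far (c i.+1); rewrite d1 i1V in ne.
    have := ne ltac:(by []) ltac:(by []).
    have neZ := bip (u := c i.+1) ZV; have neW := bip (u := c i.+1) ZW.
    have := gdist_step conn (c i.+1) ZW.
    have := gdist_tri conn (c i.+1) (c i) W; rewrite dW d1.
    rewrite edge_sym in ZV; have := gdist_step conn (c i.+1) ZV; rewrite i1V.
    have := gdist_tri conn (c i.+1) (c i) Z; rewrite dT d1.
    rewrite i1V in neZ; lia.
  move=> y; rewrite (_ : i + K.+2 + K = i + n) ?cP; last by rewrite /n; lia.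
  rewrite (_ : i + K.+2 + K.+2 = i.+2 + n) ?cP; last by rewrite /n; lia.
  rewrite -/W => uy i2y dWy.
  have dy := gdist_edge conn uy.
  have yV : gdist y V = k.
    have := gdist_tri conn y (c i) V; rewrite dV dy.
    have := gdist_tri conn (c i.+2) y V.
    rewrite (gdistC conn y (c i.+2)) (gdist_edge conn i2y).
    have := gdist_walk_le ce i.+2 k.-1.
    rewrite (_ : i.+2 + k.-1 = i + K); last lia.
    by rewrite -/V; lia.
  by apply: (far y); rewrite ?dy ?yV ?EK // gdistC.
have badE i : bad (i + n) -> bad i.
  rewrite /bad !(addnAC i n) !cP; exact.
(* Steps of size [K.+2] need not reach every vertex, but they reach one of each antipodal pair,
   which is enough because distance is symmetric. *)
have badD i : bad i \/ bad (i + K.+1).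
  elim: i => [|i [] /badS H]; [by left|right|left].
    by rewrite addSnnS.
  by apply: badE; rewrite (_ : i.+1 + n = i + K.+1 + K.+2) // /n; lia.
have cD i : gdist (c i) (c (i + n./2)) = n./2.
  rewrite (_ : n./2 = K.+1); last by rewrite /n; lia.
  case: (badD i) => [] [//]; rewrite gdistC //.
  by rewrite (_ : i + K.+1 + K.+1 = i + n) ?cP // /n; lia.
have cyc : isocycle n c by split.
have n6 : n = 6 by have := isocycle46 _ cyc; rewrite /n; lia.
have K2 : K = 2 by move: n6; rewrite /n; lia.
rewrite n6 in cyc; have [m [m0 m2 m4]] := isocycle6 cyc.
(* Now [k = 1], and [c 2] and [c 4] are the neighbors of the top [c 3], so [m] is the vertex that
   [bad 0] denies. *)
case: bad0 => _ /(_ m); rewrite !add0n K2 (gdist_edge conn m0) => H.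
by apply: (H m2 m4); move: K2; rewrite EK => -[].
Qed.

End QuadrangleCondition.

End Cycles.

(** * Medians from the quadrangle condition *)

Section Medians.
Variable G : sgraph.
Hypothesis conn : graph_connected G.
Hypothesis bip : forall u x y : G, edge x y -> gdist u x <> gdist u y.
Hypothesis quad : quadrangle_condition G.
Implicit Types u v w x y z : G.

Lemma bipartite_step u x y : edge x y ->
  gdist u x = (gdist u y).+1 \/ gdist u y = (gdist u x).+1.
Proof.
move=> xy; have := gdist_step conn u xy; have := bip (u := u) xy.
by rewrite edge_sym in xy; have := gdist_step conn u xy; lia.
Qed.

Lemma quadrangle u z v w : edge z v -> edge z w -> v <> w ->
    gdist u z = (gdist u v).+1 -> gdist u w = gdist u v ->
  exists x, [/\ edge v x, edge w x & (gdist u x).+1 = gdist u v].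
Proof.
move=> zv zw vw dz dw; case E: (gdist u v) => [|k].
  by case: vw; rewrite -(gdist_eq0 conn E); apply: (gdist_eq0 conn); rewrite dw.
have [x [vx wx dx]] := quad zv zw (etrans dz (congr1 S E)) E (etrans dw E).
by exists x; rewrite dx.
Qed.

(** If the first step [v'] of a geodesic to [w] leads away from [u], induction at [v'] either
    descends at [w] or makes [v'] a peak between [v] and [v'']. The quadrangle condition then
    replaces the peak by a vertex nearer to [u]. *)
Lemma descent u v w : v <> w ->
  (exists v', [/\ edge v v', gdist v w = (gdist v' w).+1 & gdist u v = (gdist u v').+1])
  \/ (exists w', [/\ edge w w', gdist v w = (gdist v w').+1 & gdist u w = (gdist u w').+1]).
Proof.
move: {2}(gdist v w) (erefl (gdist v w)) => m.
elim: m v => [|m IHm] v dvw vw; first by case: vw; apply: (gdist_eq0 conn).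
have [v' vv' dv'w] := gdist_next conn dvw.
have [dv|dv] := bipartite_step u vv'; first by left; exists v'; rewrite dvw dv'w.
have [E|/eqP v'w] := eqVneq v' w.
  right; exists v; rewrite -E edge_sym vv' gdist0 // gdistC // gdist_edge //.
  by rewrite edge_sym.
case: (IHm v' dv'w v'w) => [[v'' [v'v'' dv'' duv'']]|[w' [ww' dw' duw']]]; last first.
  right; exists w'; split=> //.
  have := gdist_tri conn v' v w'; rewrite (gdist_edge conn vv').
  have := gdist_step conn v (etrans (edge_sym w' w) ww'); lia.
rewrite edge_sym in vv'; have := quadrangle vv' v'v'' _ dv.
case=> [E||x [vx v''x dx]]; first by move: dvw; rewrite E -dv'w dv''; lia.
  by lia.
left; exists x; split=> //.
have := gdist_step conn w v''x; have := gdist_tri conn x v w.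
rewrite (gdist_edge conn vx) !(gdistC conn w); lia.
Qed.

(** By [descent], one of [v], [w] can move to a neighbor that is nearer both to the other and to
    [u]. A median of the new triple is a median of the old one, and the sum of the distances
    drops. *)
Lemma median_exists u v w : exists m, is_median u v w m.
Proof.
have [n] := ubnP (gdist u v + gdist v w + gdist u w).
elim: n u v w => // n IHn u v w lt_n.
have [->|/eqP vw] := eqVneq v w.
  by exists w; rewrite /is_median gdist0 // !addn0.
case: (descent u vw) => [[v' [vv' d1 d2]]|[w' [ww' d1 d2]]].
- have [|m [m1 m2 m3]] := IHn u v' w.
    by move: lt_n; rewrite d1 d2; lia.
  exists m; split=> //.
  + apply/eqP; rewrite eqn_leq gdist_tri // andbT d2 -m1 (gdistC conn m v).
    by have := gdist_tri conn v' v m; rewrite (gdist_edge conn vv') (gdistC conn m v'); lia.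
  + apply/eqP; rewrite eqn_leq gdist_tri // andbT d1 -m2.
    by have := gdist_tri conn v' v m; rewrite (gdist_edge conn vv'); lia.
- have [|m [m1 m2 m3]] := IHn u v w'.
    by move: lt_n; rewrite d1 d2; lia.
  exists m; split=> //.
  + apply/eqP; rewrite eqn_leq gdist_tri // andbT d1 -m2 (gdistC conn m w).
    by have := gdist_tri conn w' w m; rewrite (gdist_edge conn ww') (gdistC conn m w'); lia.
  + apply/eqP; rewrite eqn_leq gdist_tri // andbT d2 -m3 (gdistC conn m w).
    by have := gdist_tri conn w' w m; rewrite (gdist_edge conn ww') (gdistC conn m w'); lia.
Qed.

Lemma is_median_toward u v w m x : is_median u v w m ->
  gdist u m = (gdist x m).+1 -> edge u x -> is_median x v w m.
Proof.
move=> [m1 m2 m3] dx /(gdist_edge conn) ux; split=> //; apply/eqP.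
  rewrite eqn_leq gdist_tri // andbT.
  by have := gdist_tri conn x u v; rewrite ux; lia.
rewrite eqn_leq gdist_tri // andbT.
by have := gdist_tri conn x u w; rewrite ux; lia.
Qed.

Hypothesis noK23 : forall a b x y z, a <> b -> x <> y -> y <> z -> x <> z ->
  edge a x -> edge a y -> edge a z -> edge b x -> edge b y -> edge b z -> False.

(** The pairwise distances determine the distance from [u] to a median. If the first steps [u1],
    [u2] toward two medians agree, the triple shrinks. Otherwise they have common neighbors [a]
    nearer to [v] and [b] nearer to [w]; both differ from [u], so [K_{2,3}]-freeness forces
    [a = b]. *)
Lemma median_unique u v w x y : is_median u v w x -> is_median u v w y -> x = y.
Proof.
have [n] := ubnP (gdist u v + gdist v w + gdist u w).
elim: n u v w x y => // n IHn u v w x y lt_n mx my.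
have [[x1 x2 x3] [y1 y2 y3]] := (mx, my).
have dE : gdist u x = gdist u y.
  by move: x1 x2 x3 y1 y2 y3; rewrite !(gdistC conn v); lia.
case dx: (gdist u x) (dE) => [|k] dy.
  by rewrite -(gdist_eq0 conn dx); apply: (gdist_eq0 conn).
have [u1 uu1 du1] := gdist_next conn dx.
have [u2 uu2 du2] := gdist_next conn (esym dy).
have mx1 : is_median u1 v w x by apply: is_median_toward mx _ uu1; rewrite dx du1.
have my2 : is_median u2 v w y by apply: is_median_toward my _ uu2; rewrite -dy du2.
have near i m : edge u i -> is_median u v w m -> is_median i v w m ->
    gdist u m = (gdist i m).+1 ->
    gdist u v = (gdist i v).+1 /\ gdist u w = (gdist i w).+1.
  by move=> ui [? ? ?] [? ? ?] ?; split; lia.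
have [du1v du1w] := near _ _ uu1 mx mx1 ltac:(by rewrite dx du1).
have [du2v du2w] := near _ _ uu2 my my2 ltac:(by rewrite -dy du2).
have IH i m m' : gdist u v = (gdist i v).+1 -> gdist u w = (gdist i w).+1 ->
    is_median i v w m -> is_median i v w m' -> m = m'.
  by move=> d1 d2; apply: IHn; lia.
have [E|/eqP u12] := eqVneq u1 u2.
  by apply: (IH u1) => //; rewrite E.
have [|a [u1a u2a da]] := quadrangle (u := v) uu1 uu2 u12 ltac:(by rewrite !(gdistC conn v)).
  by rewrite !(gdistC conn v); lia.
have [|b [u1b u2b db]] := quadrangle (u := w) uu1 uu2 u12 ltac:(by rewrite !(gdistC conn w)).
  by rewrite !(gdistC conn w); lia.
have [E|/eqP ab] := eqVneq a b; last first.
  case: (noK23 (a := u1) (b := u2) (x := u) (y := a) (z := b)) => //.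
  - by move=> E; move: da; rewrite -E !(gdistC conn v); lia.
  - by move=> E; move: db; rewrite -E !(gdistC conn w); lia.
  - by rewrite edge_sym.
  - by rewrite edge_sym.
(* Now [a] lies between [u] and both [v] and [w], and any median of [a], [v], [w]
   is a median reached from [u] through [u1] as well as through [u2]. *)
rewrite -{b}E in db u1b u2b.
have [m [m1 m2 m3]] := median_exists a v w.
have mi i : gdist u v = (gdist i v).+1 -> gdist u w = (gdist i w).+1 ->
    edge i a -> (gdist v a).+1 = gdist v i -> (gdist w a).+1 = gdist w i ->
    is_median i v w m.
  move=> d1 d2 ia d3 d4; split=> //; apply/eqP; rewrite eqn_leq gdist_tri // andbT.
    rewrite (gdistC conn i v) -d3 (gdistC conn v a) -m1.
    by have := gdist_tri conn a i m; rewrite (gdist_edge conn ia); lia.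
  rewrite (gdistC conn i w) -d4 (gdistC conn w a) -m3.
  by have := gdist_tri conn a i m; rewrite (gdist_edge conn ia); lia.
have E1 : x = m.
  by apply: (IH u1) => //; apply: mi => //; rewrite ?da ?db.
have E2 : y = m.
  by apply: (IH u2) => //; apply: mi => //; rewrite ?da ?db;
    [rewrite !(gdistC conn v) | rewrite !(gdistC conn w)]; lia.
by rewrite E1 E2.
Qed.

End Medians.

(** * Subgraphs *)

Section ImageSubgraph.
Variables (H G : sgraph) (g : H -> G).
Hypothesis g_hom : forall x y, edge x y -> edge (g x) (g y).

Definition image_edge : rel G :=
  fun x y => [exists i, exists j, [&& edge i j, x == g i & y == g j]].

Lemma image_edgeP x y :
  reflect (exists i j, [/\ edge i j, x = g i & y = g j]) (image_edge x y).
Proof.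
apply: (iffP existsP) => [[i /existsP[j /and3P[ij /eqP-> /eqP->]]]|[i [j [ij -> ->]]]].
  by exists i, j.
by exists i; apply/existsP; exists j; rewrite ij !eqxx.
Qed.

Lemma image_edge_sym : symmetric image_edge.
Proof.
move=> x y; apply/image_edgeP/image_edgeP => -[i [j [ij -> ->]]];
  by exists j, i; rewrite edge_sym.
Qed.

Lemma image_edge_sub x y : image_edge x y ->
  [&& x \in [set g i | i in H], y \in [set g i | i in H] & edge x y].
Proof. by case/image_edgeP => i [j [ij -> ->]]; rewrite !imset_f // g_hom. Qed.

Definition image_subgraph := Subgraph image_edge_sym image_edge_sub.

End ImageSubgraph.

Lemma bijective_of_inj_surj (A B : Type) (g : A -> B) :
  injective g -> (forall y, exists x, g x = y) -> bijective g.
Proof.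
move=> g_inj /choice[f fK]; exists f => // x.
by apply: g_inj; rewrite fK.
Qed.

Lemma isomorphic_inv (G H : sgraph) (g : H -> G) :
  bijective g -> {mono g : x y / edge x y} -> isomorphic G H.
Proof.
case=> f fK gK g_mono; exists f; split; first by exists g.
by move=> x y; rewrite -g_mono !gK.
Qed.

Lemma image_subgraph_isomorphic (H G : sgraph) (g : H -> G)
    (g_hom : forall x y, edge x y -> edge (g x) (g y)) :
  injective g -> isomorphic (image_subgraph g_hom) H.
Proof.
move=> g_inj.
have mem i : g i \in sub_vertices (image_subgraph g_hom) by rewrite imset_f.
apply: (@isomorphic_inv _ _ (fun i => exist _ (g i) (mem i) : image_subgraph g_hom)).
  apply: bijective_of_inj_surj => [i j [] /g_inj //|[x xC]].
  by case/imsetP: (xC) => i _ E; exists i; apply: val_inj; rewrite /= E.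
move=> i j; apply/image_edgeP/idP => [[i' [j' [ij /= /g_inj-> /g_inj->]]] //|ij].
by exists i, j.
Qed.

Lemma subgraph_copy (H G : sgraph) (K : subgraph G) : isomorphic K H ->
  exists g : H -> G, [/\ injective g, {mono g : i j / edge i j >-> sub_edge K i j} &
    forall x, x \in sub_vertices K -> exists i, g i = x].
Proof.
case=> f [[h fK hK] f_mono]; exists (fun i => val (h i)); split.
- by move=> i j /val_inj E; rewrite -(hK i) E hK.
- by move=> i j; rewrite -[RHS](congr2 edge (hK i) (hK j)) f_mono.
- by move=> x xK; exists (f (exist _ x xK)); rewrite fK.
Qed.

Section SubgraphDistance.
Variables (G : sgraph) (H : subgraph G).
Hypothesis connH : graph_connected H.

Lemma gdist_subgraph_ge (x y : H) : gdist (val x) (val y) <= gdist x y.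
Proof.
have [p [pP py <-]] := gdist_walk (connH x y).
rewrite -(size_map val p) -py -last_map; apply: gdist_le_size.
elim: p x {py} pP => //= z p IHp x /andP[xz zp].
by rewrite IHp // andbT; case/and3P: (sub_edgeP xz).
Qed.

End SubgraphDistance.

(** * Isometric cycles as subgraphs and as periodic walks *)

Section CycleSubgraphs.
Variable G : sgraph.
Hypothesis conn : graph_connected G.

Lemma walk_connected (H : sgraph) (c : nat -> H) :
    (forall i, edge (c i) (c i.+1)) -> (forall x, exists i, c i = x) ->
  graph_connected H.
Proof.
move=> ce cS.
have c0 i : connect edge (c 0) (c i).
  elim: i => [|i IHi]; first exact: connect0.
  exact: connect_trans IHi (connect1 (ce i)).
move=> x y; have [[i <-] [j <-]] := (cS x, cS y).
apply: connect_trans (c0 j); by rewrite (sym_connect_sym (@edge_sym H)) c0.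
Qed.

Lemma isocycle_inj n (c : nat -> G) i j : isocycle n c ->
  i < n -> j < n -> c i = c j -> i = j.
Proof.
move=> cyc; wlog lt_ij : i j / i <= j => [W ii jj E|_].
  by case/orP: (leq_total i j) => ?; [|apply/esym]; apply: W.
move=> jn E.
have [[_ cP _] d] := (cyc, fun i j => @isocycle_gdist G conn n c i j cyc).
have [le|gt] := leqP (j - i) n./2.
  by have := d i (j - i) le; rewrite subnKC // E gdist0; lia.
have := d j (n - (j - i)); rewrite (_ : j + _ = i + n) ?cP ?E ?gdist0; lia.
Qed.

(** Of the two arcs between two vertices, the shorter one lies in [C] and is as long as their
    distance in [G], so distances in [C] do not exceed those in [G]. *)
Lemma isocycle_subgraph n (c : nat -> G) : 3 <= n -> isocycle n c ->
  exists C : subgraph G, [/\ is_cycle n C, isometric C &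
    forall i, sub_edge C (c i) (c i.+1)].
Proof.
case: n => // n n3 cyc; have [ce cP cd] := cyc.
have cM i : c (i %% n.+1) = c i.
  by rewrite {2}(divn_eq i n.+1) addnC (periodic_mul cP).
have g_hom (i j : cycle_graph n.+1) : edge i j -> edge (c i) (c j).
  by case/andP=> _ /orP[] /eqP <-; rewrite /= cM ?ce // edge_sym ce.
pose C := image_subgraph g_hom.
have g_inj : injective (fun i : cycle_graph n.+1 => c i).
  by move=> i j /(isocycle_inj cyc (ltn_ord i) (ltn_ord j))/ord_inj.
have ne i : i %% n.+1 != i.+1 %% n.+1.
  rewrite succ_modn; case: ifP => [/eqP->|_]; first by move: n3; case: (n).
  by rewrite neq_ltn ltnSn.
have Ce i : sub_edge C (c i) (c i.+1).
  apply/image_edgeP; exists (Ordinal (ltn_pmod i (ltn0Sn n))).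
  exists (Ordinal (ltn_pmod i.+1 (ltn0Sn n))); split; rewrite /= ?cM //.
  apply/andP; split; first exact: ne.
  by apply/orP; left; apply/eqP/val_inj; rewrite /= -[(i %% n.+1).+1]addn1 modnDml addn1.
have mem i : c i \in sub_vertices C by case/and3P: (sub_edgeP (Ce i)).
pose gC i : C := exist _ (c i) (mem i).
have gCe i : edge (gC i) (gC i.+1) by apply: Ce.
have gCS (x : C) : exists i, gC i = x.
  case: x => x xC; case/imsetP: (xC) => i _ E.
  by exists i; apply: val_inj; rewrite /= E.
have connC := walk_connected gCe gCS.
exists C; split=> //.
  by split=> //; apply: image_subgraph_isomorphic.
move=> x y; apply/eqP; rewrite eqn_leq gdist_subgraph_ge // andbT.
have near i t : t <= n.+1./2 -> gdist (gC i) (gC (i + t)) <= gdist (c i) (c (i + t)).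
  by move=> le; rewrite (isocycle_gdist conn _ cyc le) gdist_walk_le.
have {}gCS z : exists2 i, i < n.+1 & gC i = z.
  have [i <-] := gCS z; exists (i %% n.+1); first by rewrite ltn_mod.
  by apply: val_inj; rewrite /= cM.
have [[i lt_i <-] [j lt_j <-]] := (gCS x, gCS y).
wlog le_ij : i j lt_i lt_j / i <= j.
  move=> W; case/orP: (leq_total i j) => le; first exact: W.
  by rewrite (gdistC connC) (gdistC conn); apply: W.
have [le|gt] := leqP (j - i) n.+1./2.
  by have := near i _ le; rewrite subnKC.
have := near j (n.+1 - (j - i)); rewrite (_ : j + _ = i + n.+1); last lia.
have -> : gC (i + n.+1) = gC i by apply: val_inj; apply: cP.
rewrite cP (gdistC connC) (gdistC conn); apply; lia.
Qed.

(** A potential that grows by at most one along each edge bounds distances from below; this is how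
    distances inside an abstract cycle are computed. *)
Lemma gdist_lipschitz (H : sgraph) (phi : H -> nat) : graph_connected H ->
    (forall x y, edge x y -> phi y <= (phi x).+1) ->
  forall x y, phi y <= phi x + gdist x y.
Proof.
move=> connH lip x y; have [p [pP <- <-]] := gdist_walk (connH x y).
elim: p x pP => [|z p IHp] x /=; first by rewrite addn0.
by case/andP=> /lip xz /IHp zp; apply: leq_trans zp _; lia.
Qed.

Lemma subgraph_isocycle n (C : subgraph G) : is_cycle n C -> isometric C ->
  exists c : nat -> G, [/\ isocycle n c,
    forall i, sub_edge C (c i) (c i.+1),
    forall x, x \in sub_vertices C -> exists2 i, i < n & x = c i &
    forall x y, sub_edge C x y -> exists2 i, i < n &
      (x = c i /\ y = c i.+1) \/ (y = c i /\ x = c i.+1)].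
Proof.
case: n => [[]//|n] [n3 [f [[g fK gK] f_mono]]] Ciso.
pose c i : C := g (inord (i %% n.+1)).
have fc i : f (c i) = i %% n.+1 :> nat by rewrite /c gK inordK ?ltn_mod.
have ce i : edge (c i) (c i.+1).
  rewrite -f_mono; apply/andP; rewrite -!val_eqE /= !fc; split.
    rewrite succ_modn; case: ifP => [/eqP->|_]; first by move: n3; case: (n).
    by rewrite neq_ltn ltnSn.
  by rewrite -[(i %% n.+1).+1]addn1 modnDml addn1 eqxx.
have cS x : exists i, c i = x.
  by exists (f x); rewrite /c modn_small // inord_val fK.
have connC := walk_connected ce cS.
exists (fun i => val (c i)); split; last first.
- move=> x y xy; case/and3P: (sub_edgeP xy) => xC yC _.
  pose x' : C := exist _ x xC; pose y' : C := exist _ y yC.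
  have next (u v : C) : ordS (f u) = f v -> c (f u) = u /\ c (f u).+1 = v.
    move=> E; rewrite /c modn_small // inord_val fK; split=> //.
    by rewrite -[v]fK -E; congr g; apply: val_inj; rewrite /= inordK // ltn_mod.
  have : edge (f x') (f y') by rewrite f_mono.
  case/andP=> _ /orP[] /eqP/next[E1 E2].
    by exists (f x') => //; left; rewrite E1 E2.
  by exists (f y') => //; right; rewrite E1 E2.
- move=> x xC; exists (f (exist _ x xC : C)) => //.
  by rewrite /c modn_small // inord_val fK.
- by move=> i; apply: ce.
split.
- by move=> i; case/and3P: (sub_edgeP (ce i)).
- by move=> i; rewrite /c modnDr.
move=> i; rewrite -Ciso; apply/eqP; rewrite eqn_leq gdist_walk_le //=.
(* [r x] is the position of [x] counted from [c i], and [phi x] the length of the shorter arc from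
   [c i] to [x]. *)
pose r x := (f x + (n.+1 - i %% n.+1)) %% n.+1.
pose phi x := minn (r x) (n.+1 - r x).
have r_lt x : r x < n.+1 by rewrite ltn_mod.
have rS x y : ordS (f x) = f y -> r y = if r x == n then 0 else (r x).+1.
  move=> E; rewrite /r -succ_modn -E /= modnDml -addSn //.
have lip x y : edge x y -> phi y <= (phi x).+1.
  rewrite -f_mono => /andP[_ /orP[] /eqP/rS]; rewrite /phi;
  have := r_lt x; have := r_lt y; case: eqP; lia.
have := gdist_lipschitz connC lip (c i) (c (i + n.+1./2)).
have -> : phi (c i) = 0.
  rewrite /phi /r fc subnKC ?modnn ?min0n //.
  by apply: ltnW; rewrite ltn_mod.
suff -> : phi (c (i + n.+1./2)) = n.+1./2 by [].
have E : r (c (i + n.+1./2)) = n.+1./2.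
  rewrite /r fc modnDml addnAC -modnDml -(modnDml i) subnKC; last first.
    by apply: ltnW; rewrite ltn_mod.
  by rewrite modnn add0n modn_small //; lia.
by rewrite /phi E; lia.
Qed.

End CycleSubgraphs.

(** * Copies of [K_{2,3}] and of the cube *)

Section SmallSubgraphs.
Variable G : sgraph.
Implicit Types a b x y z : G.

Lemma K23_free_common a b x y z : graph_free (complete_bipartite_graph 2 3) G ->
  a <> b -> x <> y -> y <> z -> x <> z ->
  edge a x -> edge a y -> edge a z -> edge b x -> edge b y -> edge b z -> False.
Proof.
move=> free ab xy yz xz ax ay az bx by_ bz; apply: free.
pose g (i : complete_bipartite_graph 2 3) : G :=
  match i with inl i => nth a [:: a; b] i | inr j => nth a [:: x; y; z] j end.
have g_hom i j : edge i j -> edge (g i) (g j).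
  case: i => [[[|[|//]] ?]|[[|[|[|//]]] ?]];
  case: j => [[[|[|//]] ?]|[[|[|[|//]]] ?]] //= _; rewrite // edge_sym //.
exists (image_subgraph g_hom); apply: image_subgraph_isomorphic.
have neq (u v : G) : edge u v -> u <> v by move=> uv; apply/eqP/edge_neq.
have := (neq _ _ ax, neq _ _ ay, neq _ _ az, neq _ _ bx, neq _ _ by_, neq _ _ bz).
move=> [[[[[ax' ay'] az'] bx'] by'] bz'].
move=> [[[|[|//]] ?]|[[|[|[|//]]] ?]] [[[|[|//]] ?]|[[|[|[|//]]] ?]] //= E;
  try (by case: (nesym _ E)); try (by congr inl; apply: val_inj);
  try (by congr inr; apply: val_inj); by exfalso; congruence.
Qed.

Lemma common_K23_free :
    (forall a b x y z, a <> b -> x <> y -> y <> z -> x <> z ->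
     edge a x -> edge a y -> edge a z -> edge b x -> edge b y -> edge b z -> False) ->
  graph_free (complete_bipartite_graph 2 3) G.
Proof.
move=> no [K /subgraph_copy[g [g_inj g_mono _]]].
have E i j : edge (g (inl i)) (g (inr j)).
  by have /sub_edgeP/and3P[] : sub_edge K (g (inl i)) (g (inr j)) by rewrite g_mono.
pose i0 : 'I_2 := ord0; pose i1 : 'I_2 := ord_max.
pose j0 : 'I_3 := ord0; pose j1 : 'I_3 := inord 1; pose j2 : 'I_3 := ord_max.
apply: (no (g (inl i0)) (g (inl i1)) (g (inr j0)) (g (inr j1)) (g (inr j2))) => // /g_inj.
- by [].
- by case=> /(congr1 val) /=; rewrite inordK.
- by case=> /(congr1 val) /=; rewrite inordK.
- by [].
Qed.

(** The list is ordered so that the binary digits of a position are the coordinates in the cube: [m]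
    and [m'] are opposite corners and the hexagon runs through the other six. *)
Lemma hexagon_cube (c : nat -> G) m m' :
    uniq [:: m; c 0; c 2; c 1; c 4; c 5; c 3; m'] ->
    (forall i, edge (c i) (c i.+1)) -> c 6 = c 0 ->
    edge m (c 0) -> edge m (c 2) -> edge m (c 4) ->
    edge m' (c 1) -> edge m' (c 3) -> edge m' (c 5) ->
  exists Q : subgraph G, isomorphic Q cube_Q3 /\
    forall i, i < 6 -> sub_edge Q (c i) (c i.+1).
Proof.
set s := (s in uniq s) => s_uniq ce c6 m0 m2 m4 m1 m3 m5.
pose g (v : cube_Q3) := nth m s (v.1.1 + 2 * v.1.2 + 4 * v.2).
have e50 : edge (c 5) (c 0) by rewrite -c6.
have g_hom u v : edge u v -> edge (g u) (g v).
  have := (ce 0, ce 1, ce 2, ce 3, ce 4); rewrite /g.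
  case: u => [[[[|[|//]] ?] [[|[|//]] ?]] [[|[|//]] ?]];
  case: v => [[[[|[|//]] ?] [[|[|//]] ?]] [[|[|//]] ?]] => -[[[[? ?] ?] ?] ?] //= _;
  by rewrite // edge_sym.
exists (image_subgraph g_hom); split.
  apply: image_subgraph_isomorphic => u v /eqP; rewrite nth_uniq //.
    case: u => [[[[|[|//]] ?] [[|[|//]] ?]] [[|[|//]] ?]];
    case: v => [[[[|[|//]] ?] [[|[|//]] ?]] [[|[|//]] ?]] //= _;
    by congr (_, _, _); apply: val_inj.
  - by case: u => [[[[|[|//]] ?] [[|[|//]] ?]] [[|[|//]] ?]].
  - by case: v => [[[[|[|//]] ?] [[|[|//]] ?]] [[|[|//]] ?]].
pose o : complete_graph 2 := ord0; pose l : complete_graph 2 := ord_max.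
have E (u v : cube_Q3) x y : edge u v -> g u = x -> g v = y ->
    sub_edge (image_subgraph g_hom) x y.
  by move=> uv <- <-; apply/image_edgeP; exists u, v.
move=> [|[|[|[|[|[|//]]]]]] _.
- exact: (E (l, o, o) (l, l, o)).
- exact: (E (l, l, o) (o, l, o)).
- exact: (E (o, l, o) (o, l, l)).
- exact: (E (o, l, l) (o, o, l)).
- exact: (E (o, o, l) (l, o, l)).
- exact: (E (l, o, l) (l, o, o)).
Qed.

Lemma ord2E (i : 'I_2) : i = ord0 \/ i = ord_max.
Proof. by case: i => [[|[|//]] ?]; [left|right]; apply: val_inj. Qed.

(** [h0], [h2], [h4] differ pairwise in exactly two coordinates, so their coordinatewise majority
    differs from each of them in exactly one. *)
Lemma cube_alternate_center (h0 h1 h2 h3 h4 h5 : cube_Q3) :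
    edge h0 h1 -> edge h1 h2 -> edge h2 h3 -> edge h3 h4 -> edge h4 h5 ->
    edge h5 h0 -> h0 <> h2 -> h2 <> h4 -> h0 <> h4 ->
  exists h, [/\ edge h0 h, edge h2 h & edge h4 h].
Proof.
pose differ (x y : cube_Q3) :=
  (x.1.1 != y.1.1) + (x.1.2 != y.1.2) + (x.2 != y.2).
have differ2 (x y z : cube_Q3) : edge x y -> edge y z -> x <> z -> differ x z = 2.
  move: x y z => [[x1 x2] x3] [[y1 y2] y3] [[z1 z2] z3].
  case: (ord2E x1) (ord2E x2) (ord2E x3) => -> [] -> [] ->;
  case: (ord2E y1) (ord2E y2) (ord2E y3) => -> [] -> [] -> //;
  by case: (ord2E z1) (ord2E z2) (ord2E z3) => -> [] -> [] ->.
move=> h01 h12 h23 h34 h45 h50 n02 n24 n04.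
have d02 := differ2 _ _ _ h01 h12 n02; have d24 := differ2 _ _ _ h23 h34 n24.
have d40 := differ2 _ _ _ h45 h50 (nesym n04).
pose maj (x y z : 'I_2) := if x == y then x else z.
exists (maj h0.1.1 h2.1.1 h4.1.1, maj h0.1.2 h2.1.2 h4.1.2, maj h0.2 h2.2 h4.2).
move: d02 d24 d40; rewrite {h01 h12 h23 h34 h45 h50 n02 n24 n04}.
move: h0 h2 h4 => [[x1 x2] x3] [[y1 y2] y3] [[z1 z2] z3].
case: (ord2E x1) (ord2E x2) (ord2E x3) => -> [] -> [] ->;
case: (ord2E y1) (ord2E y2) (ord2E y3) => -> [] -> [] -> //;
by case: (ord2E z1) (ord2E z2) (ord2E z3) => -> [] -> [] ->.
Qed.

End SmallSubgraphs.

(** * Median graphs *)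

Lemma median_of_conditions (G : sgraph) :
    graph_connected G -> graph_free (complete_bipartite_graph 2 3) G ->
    C6iso_Q3_inferring G ->
    (forall n (C : subgraph G), is_cycle n C -> isometric C -> n = 4 \/ n = 6) ->
  median_graph G.
Proof.
move=> conn freeK inferQ cyc46.
have isocycle46 n (c : nat -> G) : 3 <= n -> isocycle n c -> n = 4 \/ n = 6.
  by move=> n3 /(isocycle_subgraph conn n3)[C [Ccyc Ciso _]]; apply: cyc46 Ccyc Ciso.
have bip : forall u x y : G, edge x y -> gdist u x <> gdist u y.
  apply: even_isocycles_bipartite => // n c n3 cyc.
  by case: (isocycle46 n c n3 cyc) => ->.
have isocycle6 (c : nat -> G) : isocycle 6 c ->
    exists m, [/\ edge (c 0) m, edge (c 2) m & edge (c 4) m].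
  move=> cyc; have [C [Ccyc Ciso Ce]] := isocycle_subgraph conn (isT : 2 < 6) cyc.
  have [Q [Qcube [CQv CQe]]] := inferQ C Ccyc Ciso.
  have [g [g_inj g_mono gS]] := subgraph_copy Qcube.
  have QE i j : sub_edge Q (g i) (g j) -> edge i j by rewrite g_mono.
  have h i : exists a, g a = c i.
    by apply: gS; apply: (fintype.subsetP CQv); case/and3P: (sub_edgeP (Ce i)).
  have [[h0 E0] [[h1 E1] [[h2 E2] [[h3 E3] [[h4 E4] [h5 E5]]]]]] :=
    (h 0, (h 1, (h 2, (h 3, (h 4, h 5))))).
  have ne i j : i < 6 -> j < 6 -> i != j -> c i <> c j.
    by move=> i6 j6 /eqP ij /(isocycle_inj conn cyc i6 j6).
  have [] := @cube_alternate_center h0 h1 h2 h3 h4 h5; first 6 last.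
  - by move=> E; apply: (ne 0 2) => //; rewrite -E0 E E2.
  - by move=> E; apply: (ne 2 4) => //; rewrite -E2 E E4.
  - by move=> E; apply: (ne 0 4) => //; rewrite -E0 E E4.
  - move=> m [m0 m2 m4]; exists (g m).
    have sub x : edge x m -> edge (g x) (g m).
      by rewrite -g_mono => /sub_edgeP/and3P[].
    by rewrite -E0 -E2 -E4 !sub.
  - by apply: QE; rewrite E0 E1; apply/CQe/Ce.
  - by apply: QE; rewrite E1 E2; apply/CQe/Ce.
  - by apply: QE; rewrite E2 E3; apply/CQe/Ce.
  - by apply: QE; rewrite E3 E4; apply/CQe/Ce.
  - by apply: QE; rewrite E4 E5; apply/CQe/Ce.
  - apply: QE; rewrite E5 E0; case: cyc => _ cP _.
    by rewrite -(cP 0); apply/CQe/Ce.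
have quad := isocycle_quadrangle_condition conn bip isocycle46 isocycle6.
split=> // u v w; have [m mP] := median_exists conn bip quad u v w.
exists m; split=> // x xP; apply: (median_unique conn bip quad _ mP xP).
by move=> a b x' y z; apply: K23_free_common.
Qed.

Section MedianGraphs.
Variable G : sgraph.
Hypothesis medianG : median_graph G.
Implicit Types u v w x y z : G.

Let conn : graph_connected G := proj1 medianG.

(** A median of [u] and the two ends of an edge is one of these ends, which is then strictly nearer
    to [u] than the other. *)
Lemma median_graph_bipartite u x y : edge x y -> gdist u x <> gdist u y.
Proof.
move=> xy E; have [m [[m1 m2 m3] _]] := proj2 medianG u x y.
have xy1 := gdist_edge conn xy; rewrite xy1 in m2.
case dmx: (gdist m x) m2 => [|k].
  by move=> m2; rewrite (gdist_eq0 conn dmx) xy1 in m3; lia.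
rewrite gdistC // in dmx; rewrite dmx => -[] dk.
have {}dk : gdist m y = 0 by lia.
by rewrite (gdist_eq0 conn dk) (gdistC conn y) xy1 in m1; lia.
Qed.

Lemma median_graph_triangle_free x y z : edge x y -> edge y z -> ~~ edge x z.
Proof.
move=> xy yz; apply/negP => xz.
by apply: (@median_graph_bipartite x y z yz); rewrite !gdist_edge.
Qed.

Lemma gdist_common_neighbor x y z : edge x z -> edge y z -> x <> y -> gdist x y = 2.
Proof.
move=> xz yz xy; apply/eqP; rewrite eqn_leq; apply/andP; split.
  have := gdist_tri conn z x y; rewrite (gdist_edge conn xz) (gdistC conn z).
  by rewrite (gdist_edge conn yz).
case d: (gdist x y) => [|[|k]] //.
  by case: xy; apply: (gdist_eq0 conn).
have := @median_graph_triangle_free x z y xz; rewrite edge_sym yz.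
by rewrite (edge_gdist1 conn d) => /(_ isT).
Qed.

(** In a [K_{2,3}] the three vertices of the larger side are pairwise at distance 2, and both
    vertices of the smaller side would be their medians. *)
Lemma median_graph_K23_free : graph_free (complete_bipartite_graph 2 3) G.
Proof.
apply: common_K23_free => a b x y z ab xy yz xz ax ay az bx by_ bz.
have med m : edge m x -> edge m y -> edge m z -> is_median x y z m.
  have d2 s t : edge m s -> edge m t -> s <> t -> gdist s m + gdist m t = gdist s t.
    move=> ms mt st; rewrite (gdistC conn s) (gdist_edge conn ms) (gdist_edge conn mt).
    by rewrite (@gdist_common_neighbor s t m) // edge_sym.
  by move=> mx my mz; split; apply: d2.
have [m [_ uniq_m]] := proj2 medianG x y z.
by apply: ab; rewrite -(uniq_m a) ?(uniq_m b) //; apply: med.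
Qed.

(** For [v] and [w] distinct, hence at distance 2, the required vertex is the median of [u], [v],
    [w]. *)
Lemma median_graph_quadrangle_condition : quadrangle_condition G.
Proof.
move=> u z v w k zv zw dz dv dw.
have [vw|/eqP vw] := eqVneq v w.
  have [x vx xu] := gdist_next conn (etrans (gdistC conn v u) dv).
  by exists x; rewrite -vw vx gdistC.
have d2 : gdist v w = 2 by apply: (@gdist_common_neighbor _ _ z); rewrite // edge_sym.
have [m [[m1 m2 m3] _]] := proj2 medianG u v w.
have vm : gdist v m = 1 by move: m1 m2 m3; rewrite dv dw d2 (gdistC conn m v); lia.
exists m; split; first exact: edge_gdist1.
  by apply: (edge_gdist1 conn); rewrite gdistC //; lia.
by move: m1; rewrite dv (gdistC conn m v) vm; lia.
Qed.

Lemma median_of_alternate (c : nat -> G) : isocycle 6 c ->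
  exists m, [/\ edge m (c 0), edge m (c 2) & edge m (c 4)].
Proof.
move=> cyc; have d i j := @isocycle_gdist _ conn _ c i j cyc.
have [m [[m1 m2 m3] _]] := proj2 medianG (c 0) (c 2) (c 4).
have d40 : gdist (c 0) (c 4) = 2.
  by have := d 4 2 isT; case: cyc => _ cP _; rewrite (cP 0) gdistC.
rewrite (d 0 2) // in m1; rewrite (d 2 2) // in m2; rewrite d40 in m3.
rewrite (gdistC conn (c 2) m) in m2; rewrite (gdistC conn (c 0) m) in m1 m3.
by exists m; split; apply: (edge_gdist1 conn); lia.
Qed.

Lemma isocycle_shift n (c : nat -> G) t : isocycle n c -> isocycle n (fun i => c (t + i)).
Proof. by case=> ce cP cd; split=> i; rewrite ?addnS ?addnA. Qed.

(** [m] and [m'] are the medians of the two alternate triples, listed in the order of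
    [hexagon_cube]. Were they equal, there would be a triangle; were one of them on the hexagon, an
    antipodal pair or a vertex with itself would be adjacent. *)
Lemma hexagon_Q3 (c : nat -> G) : isocycle 6 c ->
  exists m m', [/\ uniq [:: m; c 0; c 2; c 1; c 4; c 5; c 3; m'],
    [/\ edge m (c 0), edge m (c 2) & edge m (c 4)] &
    [/\ edge m' (c 1), edge m' (c 3) & edge m' (c 5)]].
Proof.
move=> cyc; have [m [m0 m2 m4]] := median_of_alternate cyc.
have [m' [m1 m3 m5]] := median_of_alternate (isocycle_shift 1 cyc).
have [ce cP cd] := cyc; have c6 : c 6 = c 0 := cP 0.
have cI i j : i < 6 -> j < 6 -> i != j -> c i != c j.
  by move=> i6 j6; apply: contra => /eqP/(isocycle_inj conn cyc i6 j6)->.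
have tf x y z : edge x y -> edge x z -> ~ edge y z.
  move=> xy xz yz; rewrite edge_sym in xy.
  by have := @median_graph_triangle_free y x z xy xz; rewrite yz.
have far i : ~ edge (c i) (c (i + 3)).
  by move=> /(gdist_edge conn); rewrite cd.
have ne x y : edge x y -> x != y by apply: edge_neq.
have E50 : edge (c 5) (c 0) by rewrite -c6.
exists m, m'; split=> //=; rewrite !inE !negb_or.
rewrite !(ne _ _ m0) ?(ne _ _ m2) ?(ne _ _ m4) !cI //= !andbT.
have mm' : m != m'.
  by apply/eqP => E; apply: (tf m (c 0) (c 1)); rewrite // E.
rewrite mm' ![_ == m']eq_sym ?(ne _ _ m1) ?(ne _ _ m3) ?(ne _ _ m5) !andbT /=.
have n1 : m != c 1 by apply/eqP => E; apply: (far 1); rewrite -E.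
have n5 : m != c 5.
  by apply/eqP => E; apply: (far 2); rewrite -E edge_sym.
have n3 : m != c 3.
  by apply/eqP => E; apply: (far 0); rewrite add0n -E edge_sym.
have n0 : m' != c 0 by apply/eqP => E; apply: (far 0); rewrite -E.
have n2 : m' != c 2 by apply/eqP => E; apply: (far 2); rewrite -E.
have n4 : m' != c 4 by apply/eqP => E; apply: (far 1); rewrite -E edge_sym.
by rewrite n1 n3 n5 n0 n2 n4.
Qed.

Lemma median_graph_C6iso_Q3_inferring : C6iso_Q3_inferring G.
Proof.
move=> C Ccyc Ciso; have [c [cyc Ce CV CE]] := subgraph_isocycle Ccyc Ciso.
have [m [m' [s_uniq [m0 m2 m4] [m1 m3 m5]]]] := hexagon_Q3 cyc.
have [ce cP cd] := cyc.
have [Q [Qcube Qe]] := hexagon_cube s_uniq ce (cP 0) m0 m2 m4 m1 m3 m5.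
exists Q; split=> //; split.
  apply/fintype.subsetP => x /CV[i i6 ->].
  by case/and3P: (sub_edgeP (Qe i i6)).
move=> x y /CE[i i6 [] [-> ->]]; first exact: Qe.
by rewrite sub_edge_sym; apply: Qe.
Qed.

Lemma isocycle_even n (c : nat -> G) : isocycle n c -> ~~ odd n.
Proof.
move=> cyc; apply/negP => n_odd; have [ce cP cd] := cyc.
apply: (@median_graph_bipartite (c 0) _ _ (ce n./2)).
rewrite -{1}[n./2]add0n cd gdistC //.
have := cd n./2.+1; have -> : n./2.+1 + n./2 = 0 + n.
  by rewrite -{3}(odd_double_half n) n_odd; lia.
by rewrite cP => ->.
Qed.

End MedianGraphs.

(** The quadrangle condition based at [c 0], applied successively at [c (k.+1 + t)], produces a path
    [f] from [c k] to [c 0] running beside the second half of [c]. The new cycle follows [c] up to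
    [c k] and returns along [f]. *)
Lemma isocycle_shrink (G : sgraph) (c : nat -> G) k : graph_connected G ->
    quadrangle_condition G -> 0 < k -> isocycle k.+1.*2 c ->
  exists c', [/\ isocycle k.*2 c', forall i, i <= k -> c' i = c i &
    forall i, i <= k -> edge (c' (k + i)) (c (k.+1 + i))].
Proof.
move=> conn quad k_gt0 cyc; have [ce cP _] := cyc.
have cd i j : j <= k.+1 -> gdist (c i) (c (i + j)) = j.
  by move=> le; apply: (isocycle_gdist conn _ cyc); rewrite doubleK.
have d0 i : i <= k.+1 -> gdist (c 0) (c (k.+1 + i)) = k.+1 - i.
  move=> le; rewrite gdistC // -[c 0]cP.
  by rewrite -{1}(cd (k.+1 + i) (k.+1 - i)); [congr (gdist _ (c _))|]; lia.
have ladder t : t <= k -> exists f : nat -> G,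
    [/\ f 0 = c k, forall i, i < t -> edge (f i) (f i.+1) &
        forall i, i <= t -> edge (f i) (c (k.+1 + i)) /\ gdist (c 0) (f i) = k - i].
  elim: t => [_|t IHt lt_tk].
    exists (fun=> c k); split=> // i; rewrite leqn0 => /eqP->.
    by rewrite addn0 ce subn0 -[in LHS](add0n k) cd.
  have [f [f0 fe fc]] := IHt (ltnW lt_tk); have [ft dft] := fc t (leqnn t).
  have [|||||x [x1 x2 dx]] := quad (c 0) (c (k.+1 + t)) (f t) (c (k.+1 + t.+1)) (k - t.+1).
  - by rewrite edge_sym.
  - by rewrite addnS.
  - by rewrite d0; lia.
  - by rewrite dft; lia.
  - by rewrite d0; lia.
  exists (fun i => if i <= t then f i else x); split=> [//|i|i].
    rewrite ltnS; case: (ltngtP i t) => // [lt|->] _; first exact: fe.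
    by rewrite x1.
  rewrite leq_eqVlt ltnS => /orP[/eqP->|le]; last by rewrite le; apply: fc.
  by rewrite ltnn edge_sym x2 dx.
have [f [f0 fe fc]] := ladder k (leqnn k).
have fk : f k = c 0.
  by have [_] := fc k (leqnn k); rewrite subnn => /(gdist_eq0 conn).
have [N EN] : exists N, k.*2 = N.+1 by exists k.*2.-1; lia.
pose c' i := let r := i %% k.*2 in if r <= k then c r else f (r - k).
have c'P i : c' (i + k.*2) = c' i by rewrite /c' modnDr.
have c'k i : i <= k -> c' (k + i) = f i.
  rewrite leq_eqVlt => /orP[/eqP->|lt].
    by rewrite addnn /c' modnn leq0n fk.
  rewrite /c' modn_small; last lia.
  case: i lt => [|i] lt; first by rewrite addn0 leqnn f0.
  by rewrite (_ : (k + i.+1 <= k) = false) ?addKn //; lia.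
have c'le i : i <= k -> c' i = c i.
  move=> le; rewrite /c'; have [E|ne] := eqVneq i k.*2; first by move: le; lia.
  by rewrite modn_small ?le //; lia.
exists c'; split=> // [|i le]; last by rewrite c'k //; case: (fc i le).
have c'e i : edge (c' i) (c' i.+1).
  have lt : i %% k.*2 < k.*2 by rewrite ltn_mod; lia.
  have -> : c' i = c' (i %% k.*2) by rewrite /c' modn_mod.
  have -> : c' i.+1 = c' (i %% k.*2).+1.
    by rewrite /c' -[i.+1]addn1 -modnDml addn1.
  move: (i %% _) lt => r lt; case: (ltnP r k) => rk.
    by rewrite !c'le // ltnW.
  by rewrite -(subnKC rk) -addnS !c'k; [apply: fe|..]; lia.
split=> // i; rewrite doubleK; apply/eqP; rewrite eqn_leq gdist_walk_le //=.
(* [f j] is adjacent to [c (k.+1 + j)], which is antipodal to [c j] on the longer cycle, so it is at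
   distance at least [k] from [c j]. *)
have base j : j < k -> k <= gdist (c' j) (c' (j + k)).
  move=> lt; rewrite addnC (c'k j (ltnW lt)) (c'le j (ltnW lt)).
  have [fj _] := fc j (ltnW lt); have := gdist_step conn (c j) fj.
  by rewrite (addnC k.+1) cd //; lia.
have lt : i %% k.*2 < k.*2 by rewrite ltn_mod; lia.
have -> : c' i = c' (i %% k.*2) by rewrite /c' modn_mod.
have -> : c' (i + k) = c' (i %% k.*2 + k) by rewrite /c' modnDml.
move: (i %% _) lt => r lt; case: (ltnP r k) => rk; first exact: base.
have := base (r - k); rewrite subnK // gdistC //.
rewrite (_ : r + k = r - k + k.*2) ?c'P; last lia.
by apply; lia.
Qed.

(** * Crossings of polygons *)

(* The three terms of [x1 x2 - x3 x4 + x5 x6 = 0] cannot all have the same sign. *)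
Definition grassmann_plucker_sign (s1 s2 s3 s4 s5 s6 : bool) :=
  ~~ (((s1 == s2) == (s3 != s4)) && ((s1 == s2) == (s5 == s6))).

Section Orientation.
Variable R : realFieldType.
Local Open Scope ring_scope.

(** Twice the signed area of the triangle [abc]. *)
Definition orient (a b c : R * R) : R :=
  (b.1 - a.1) * (c.2 - a.2) - (b.2 - a.2) * (c.1 - a.1).

Lemma orient_rot a b c : orient b c a = orient a b c.
Proof. by rewrite /orient; ring. Qed.

Lemma orient_swap a b c : orient b a c = - orient a b c.
Proof. by rewrite /orient; ring. Qed.

Lemma orient_grassmann_plucker a b c d e :
  orient a b c * orient a d e - orient a b d * orient a c e
    + orient a b e * orient a c d = 0.
Proof. by rewrite /orient; ring. Qed.

Lemma grassmann_pluckerP (x1 x2 x3 x4 x5 x6 : R) :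
    [&& x1 != 0, x2 != 0, x3 != 0, x4 != 0, x5 != 0 & x6 != 0] ->
    x1 * x2 - x3 * x4 + x5 * x6 = 0 ->
  grassmann_plucker_sign (0 < x1) (0 < x2) (0 < x3) (0 < x4) (0 < x5) (0 < x6).
Proof.
case/and5P=> n1 n2 n3 n4 /andP[n5 n6] E; rewrite /grassmann_plucker_sign.
case: (ltgtP 0 x1) n1 => // h1 _; case: (ltgtP 0 x2) n2 => // h2 _;
case: (ltgtP 0 x3) n3 => // h3 _; case: (ltgtP 0 x4) n4 => // h4 _;
case: (ltgtP 0 x5) n5 => // h5 _; case: (ltgtP 0 x6) n6 => // h6 _;
by nra.
Qed.

End Orientation.

Section Crossing.
Variables (R : realFieldType) (I : eqType) (P : I -> R * R).
Local Open Scope ring_scope.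

Hypothesis generic : forall i j k, i != j -> j != k -> i != k ->
  orient (P i) (P j) (P k) != 0.

Definition ccw i j k := 0 < orient (P i) (P j) (P k).

(** For points in general position: the segments [ab] and [cd] meet, as the line through each
    separates the ends of the other. *)
Definition crossing a b c d :=
  (ccw a b c != ccw a b d) && (ccw c d a != ccw c d b).

Definition in_triangle a b c x :=
  (ccw a b x == ccw b c x) && (ccw b c x == ccw c a x).

Lemma crossingC a b c d : crossing a b c d = crossing c d a b.
Proof. by rewrite /crossing andbC. Qed.

Lemma ccw_rot i j k : ccw j k i = ccw i j k.
Proof. by rewrite /ccw orient_rot. Qed.

Lemma ccw_swap i j k : i != j -> j != k -> i != k -> ccw j i k = ~~ ccw i j k.
Proof.
move=> ij jk ik; rewrite /ccw orient_swap oppr_gt0.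
by case: ltgtP (generic ij jk ik).
Qed.

Definition ccw_signs a b c d e :=
  grassmann_plucker_sign (ccw a b c) (ccw a d e) (ccw a b d) (ccw a c e)
                         (ccw a b e) (ccw a c d).

Lemma ccw_signsP a b c d e : uniq [:: a; b; c; d; e] -> ccw_signs a b c d e.
Proof.
rewrite /= !inE !negb_or => /and5P[/and4P[ab ac ad ae] /and3P[bc bd be] /andP[cd ce] de _].
apply: grassmann_pluckerP; last exact: orient_grassmann_plucker.
by rewrite !generic.
Qed.

(** Both claims concern the ten orientations only: all sign vectors obeying the Grassmann-Plücker
    condition at each of the five points satisfy them. The first counts how often a segment meets
    the boundary of a triangle; the second says that a straight drawing of [K_5] has an odd number
    of crossings. *)
Lemma five_points a b c d e : uniq [:: a; b; c; d; e] ->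
  [/\ crossing a b c d (+) crossing b e c d (+) crossing a e c d =
      in_triangle a b e c (+) in_triangle a b e d &
      crossing a b c d (+) crossing a c b d (+) crossing a d b c (+)
      crossing a b c e (+) crossing a c b e (+) crossing a e b c (+)
      crossing a b d e (+) crossing a d b e (+) crossing a e b d (+)
      crossing a c d e (+) crossing a d c e (+) crossing a e c d (+)
      crossing b c d e (+) crossing b d c e (+) crossing b e c d].
Proof.
move=> U; have GP p : perm_eq p [:: a; b; c; d; e] -> uniq p.
  by move=> /perm_uniq->.
have g1 := ccw_signsP U.
have g2 : ccw_signs b a c d e.
  by apply/ccw_signsP/GP/permP => f /=; lia.
have g3 : ccw_signs c a b d e.
  by apply/ccw_signsP/GP/permP => f /=; lia.
have g4 : ccw_signs d a b c e.
  by apply/ccw_signsP/GP/permP => f /=; lia.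
have g5 : ccw_signs e a b c d.
  by apply/ccw_signsP/GP/permP => f /=; lia.
move: U g1 g2 g3 g4 g5.
rewrite /= !inE !negb_or => /and5P[/and4P[ab ac ad ae] /and3P[bc bd be] /andP[cd ce] de _].
(* Used to bring every triple into the order of the list, up to sign, so that ten booleans
   remain. *)
have sw i j k : i != j -> j != k -> i != k ->
    [/\ ccw j k i = ccw i j k, ccw k i j = ccw i j k, ccw j i k = ~~ ccw i j k,
        ccw i k j = ~~ ccw i j k & ccw k j i = ~~ ccw i j k].
  move=> ij jk ik; split; first exact: ccw_rot.
  - by rewrite (ccw_rot k i j).
  - exact: ccw_swap.
  - by rewrite (ccw_rot j i k) ccw_swap.
  - by rewrite (ccw_rot i k j) (ccw_rot j i k) ccw_swap.
rewrite /ccw_signs /crossing /in_triangle.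
have [e1 e2 e3 e4 e5] := sw _ _ _ ab bc ac; rewrite ?e1 ?e2 ?e3 ?e4 ?e5 {e1 e2 e3 e4 e5}.
have [e1 e2 e3 e4 e5] := sw _ _ _ ab bd ad; rewrite ?e1 ?e2 ?e3 ?e4 ?e5 {e1 e2 e3 e4 e5}.
have [e1 e2 e3 e4 e5] := sw _ _ _ ab be ae; rewrite ?e1 ?e2 ?e3 ?e4 ?e5 {e1 e2 e3 e4 e5}.
have [e1 e2 e3 e4 e5] := sw _ _ _ ac cd ad; rewrite ?e1 ?e2 ?e3 ?e4 ?e5 {e1 e2 e3 e4 e5}.
have [e1 e2 e3 e4 e5] := sw _ _ _ ac ce ae; rewrite ?e1 ?e2 ?e3 ?e4 ?e5 {e1 e2 e3 e4 e5}.
have [e1 e2 e3 e4 e5] := sw _ _ _ ad de ae; rewrite ?e1 ?e2 ?e3 ?e4 ?e5 {e1 e2 e3 e4 e5}.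
have [e1 e2 e3 e4 e5] := sw _ _ _ bc cd bd; rewrite ?e1 ?e2 ?e3 ?e4 ?e5 {e1 e2 e3 e4 e5}.
have [e1 e2 e3 e4 e5] := sw _ _ _ bc ce be; rewrite ?e1 ?e2 ?e3 ?e4 ?e5 {e1 e2 e3 e4 e5}.
have [e1 e2 e3 e4 e5] := sw _ _ _ bd de be; rewrite ?e1 ?e2 ?e3 ?e4 ?e5 {e1 e2 e3 e4 e5}.
have [e1 e2 e3 e4 e5] := sw _ _ _ cd de ce; rewrite ?e1 ?e2 ?e3 ?e4 ?e5 {e1 e2 e3 e4 e5}.
move: (ccw a b c) (ccw a b d) (ccw a b e) (ccw a c d) (ccw a c e) (ccw a d e)
  (ccw b c d) (ccw b c e) (ccw b d e) (ccw c d e) => [] [] [] [] [] [] [] [] [] [];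
by [].
Qed.

End Crossing.

(** * Parity of the crossings of two polygons *)

Section PathCrossings.
Variables (R : realFieldType) (I : eqType) (P : I -> R * R).
Hypothesis generic : forall i j k, i != j -> j != k -> i != k ->
  (orient (P i) (P j) (P k) != 0)%R.

Definition path_crossing n (q r : nat -> I) :=
  \big[addb/false]_(b < n) \big[addb/false]_(a < n)
    crossing P (q a) (q a.+1) (r b) (r b.+1).

Definition fan n (q : nat -> I) x :=
  \big[addb/false]_(1 <= a < n) in_triangle P (q 0) (q a) (q a.+1) x.

(* The polygon closed up by the segment from [q n.+1] to [q 0] is the sum mod 2 of
   the boundaries of the triangles of the fan with apex [q 0]. *)
Lemma path_crossing_fan n (q : nat -> I) c d :
    (forall a b, a <= n.+1 -> b <= n.+1 -> q a = q b -> a = b) ->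
    (forall a, a <= n.+1 -> q a != c /\ q a != d) -> c != d ->
  \big[addb/false]_(a < n.+1) crossing P (q a) (q a.+1) c d =
  crossing P (q 0) (q n.+1) c d (+) (fan n.+1 q c (+) fan n.+1 q d).
Proof.
elim: n => [|n IHn] q_inj q_cd cd.
  by rewrite big_ord_recr big_ord0 /fan !big_nil /= addbF.
rewrite big_ord_recr /= IHn //; last first.
- by move=> a le; apply: q_cd; apply: leqW.
- by move=> a b la lb; apply: q_inj; apply: leqW.
have U : uniq [:: q 0; q n.+1; c; d; q n.+2].
  have ne a b : a <= n.+2 -> b <= n.+2 -> a != b -> q a != q b.
    by move=> la lb; apply: contra => /eqP/(q_inj _ _ la lb)/eqP.
  have [q0c q0d] := q_cd 0 isT; have [q1c q1d] := q_cd n.+1 (leqnSn _).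
  have [q2c q2d] := q_cd n.+2 (leqnn _).
  have e12 : q n.+1 != q n.+2 by rewrite ne // neq_ltn ltnSn.
  rewrite /= !inE !negb_or (eq_sym c (q n.+2)) (eq_sym d (q n.+2)).
  by rewrite q0c q0d q1c q1d cd q2c q2d e12 !ne.
have [T _] := five_points generic U.
rewrite /fan !(big_nat_recr n.+1) //= -/(fan n.+1 q c) -/(fan n.+1 q d).
move: T.
case: (crossing _ (q 0) (q n.+1) c d); case: (crossing _ (q n.+1) _ c d);
case: (crossing _ (q 0) (q n.+2) c d); case: (fan _ _ c); case: (fan _ _ d);
by case: (in_triangle _ _ _ _ c); case: (in_triangle _ _ _ _ d).
Qed.

Lemma addb_telescope n (g : nat -> bool) :
  \big[addb/false]_(b < n) (g b (+) g b.+1) = g 0 (+) g n.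
Proof.
elim: n => [|n IHn]; first by rewrite big_ord0 addbb.
by rewrite big_ord_recr IHn /= addbA addbK.
Qed.

(** First [q] is straightened against each segment of [r], where the fan terms telescope to the ends
    of [r]; then [r] is straightened against the single segment that replaced [q]. *)
Lemma path_crossingE n (q r : nat -> I) :
    (forall a b, a <= n.+1 -> b <= n.+1 -> q a = q b -> a = b) ->
    (forall a b, a <= n.+1 -> b <= n.+1 -> r a = r b -> a = b) ->
    (forall a b, a <= n.+1 -> b <= n.+1 -> q a != r b) ->
  path_crossing n.+1 q r =
  crossing P (q 0) (q n.+1) (r 0) (r n.+1)
    (+) (fan n.+1 q (r 0) (+) fan n.+1 q (r n.+1))
    (+) (fan n.+1 r (q 0) (+) fan n.+1 r (q n.+1)).
Proof.
move=> q_inj r_inj qr; rewrite /path_crossing.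
rewrite (eq_bigr (fun b : 'I_n.+1 =>
    crossing P (q 0) (q n.+1) (r b) (r b.+1) (+)
    (fan n.+1 q (r b) (+) fan n.+1 q (r b.+1)))); last first.
  move=> b _; have lt_b := ltn_ord b; apply: path_crossing_fan; first exact: q_inj.
    by move=> a la; rewrite !qr ?(ltnW lt_b).
  by apply/eqP => E; have := r_inj _ _ (ltnW lt_b) lt_b E; lia.
rewrite big_split /= (addb_telescope _ (fun b => fan n.+1 q (r b))).
rewrite (eq_bigr (fun b : 'I_n.+1 => crossing P (r b) (r b.+1) (q 0) (q n.+1)));
  last by move=> b _; rewrite crossingC.
rewrite path_crossing_fan; [|exact: r_inj| |]; last first.
- by apply/eqP => /(q_inj 0 n.+1 isT (leqnn _)).
- by move=> a la; rewrite ![r a == _]eq_sym !qr.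
by rewrite (crossingC P (r 0)) addbAC.
Qed.

End PathCrossings.

(* Each [w i j k] occurs twice, as [k] lies on two of the three edges disjoint
   from [ij]. *)
Lemma addb_disjoint_edges (w : nat -> nat -> nat -> bool) :
  (w 0 1 2 (+) w 0 1 3 (+) (w 2 3 0 (+) w 2 3 1)) (+)
  (w 0 2 1 (+) w 0 2 3 (+) (w 1 3 0 (+) w 1 3 2)) (+)
  (w 0 3 1 (+) w 0 3 2 (+) (w 1 2 0 (+) w 1 2 3)) (+)
  (w 0 1 2 (+) w 0 1 4 (+) (w 2 4 0 (+) w 2 4 1)) (+)
  (w 0 2 1 (+) w 0 2 4 (+) (w 1 4 0 (+) w 1 4 2)) (+)
  (w 0 4 1 (+) w 0 4 2 (+) (w 1 2 0 (+) w 1 2 4)) (+)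
  (w 0 1 3 (+) w 0 1 4 (+) (w 3 4 0 (+) w 3 4 1)) (+)
  (w 0 3 1 (+) w 0 3 4 (+) (w 1 4 0 (+) w 1 4 3)) (+)
  (w 0 4 1 (+) w 0 4 3 (+) (w 1 3 0 (+) w 1 3 4)) (+)
  (w 0 2 3 (+) w 0 2 4 (+) (w 3 4 0 (+) w 3 4 2)) (+)
  (w 0 3 2 (+) w 0 3 4 (+) (w 2 4 0 (+) w 2 4 3)) (+)
  (w 0 4 2 (+) w 0 4 3 (+) (w 2 3 0 (+) w 2 3 4)) (+)
  (w 1 2 3 (+) w 1 2 4 (+) (w 3 4 1 (+) w 3 4 2)) (+)
  (w 1 3 2 (+) w 1 3 4 (+) (w 2 4 1 (+) w 2 4 3)) (+)
  (w 1 4 2 (+) w 1 4 3 (+) (w 2 3 1 (+) w 2 3 4)) = false.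
Proof.
(* Signs turn [(+)] into multiplication, so that [ring] can collect the thirty factors into a
   square. *)
pose sgn (x : bool) : int := (if x then -1 else 1)%R.
have sgnD x y : sgn (x (+) y) = (sgn x * sgn y)%R by case: x; case: y.
have sgn2 x : (sgn x ^+ 2 = 1)%R by case: x.
suff: sgn (
  (w 0 1 2 (+) w 0 1 3 (+) (w 2 3 0 (+) w 2 3 1)) (+)
  (w 0 2 1 (+) w 0 2 3 (+) (w 1 3 0 (+) w 1 3 2)) (+)
  (w 0 3 1 (+) w 0 3 2 (+) (w 1 2 0 (+) w 1 2 3)) (+)
  (w 0 1 2 (+) w 0 1 4 (+) (w 2 4 0 (+) w 2 4 1)) (+)
  (w 0 2 1 (+) w 0 2 4 (+) (w 1 4 0 (+) w 1 4 2)) (+)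
  (w 0 4 1 (+) w 0 4 2 (+) (w 1 2 0 (+) w 1 2 4)) (+)
  (w 0 1 3 (+) w 0 1 4 (+) (w 3 4 0 (+) w 3 4 1)) (+)
  (w 0 3 1 (+) w 0 3 4 (+) (w 1 4 0 (+) w 1 4 3)) (+)
  (w 0 4 1 (+) w 0 4 3 (+) (w 1 3 0 (+) w 1 3 4)) (+)
  (w 0 2 3 (+) w 0 2 4 (+) (w 3 4 0 (+) w 3 4 2)) (+)
  (w 0 3 2 (+) w 0 3 4 (+) (w 2 4 0 (+) w 2 4 3)) (+)
  (w 0 4 2 (+) w 0 4 3 (+) (w 2 3 0 (+) w 2 3 4)) (+)
  (w 1 2 3 (+) w 1 2 4 (+) (w 3 4 1 (+) w 3 4 2)) (+)
  (w 1 3 2 (+) w 1 3 4 (+) (w 2 4 1 (+) w 2 4 3)) (+)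
  (w 1 4 2 (+) w 1 4 3 (+) (w 2 3 1 (+) w 2 3 4))) = 1%R by case: (_ (+) _).
rewrite !sgnD; pose s i j k := sgn (w i j k).
transitivity ((
    s 0 1 2 * s 0 1 3 * s 0 1 4 * s 0 2 1 * s 0 2 3 * s 0 2 4 *
    s 0 3 1 * s 0 3 2 * s 0 3 4 * s 0 4 1 * s 0 4 2 * s 0 4 3 *
    s 1 2 0 * s 1 2 3 * s 1 2 4 * s 1 3 0 * s 1 3 2 * s 1 3 4 *
    s 1 4 0 * s 1 4 2 * s 1 4 3 * s 2 3 0 * s 2 3 1 * s 2 3 4 *
    s 2 4 0 * s 2 4 1 * s 2 4 3 * s 3 4 0 * s 3 4 1 * s 3 4 2) ^+ 2)%R;
  last by rewrite !exprMn /s !sgn2 !mulr1.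
by rewrite /s; ring.
Qed.

(** If every pair crossed evenly, each straight crossing would equal its fan terms. Summed over the
    fifteen pairs of disjoint edges these cancel, whereas [five_points] makes the sum odd. *)
Lemma K5_paths_cross (R : realFieldType) (I : eqType) (P : I -> R * R)
    (b : nat -> I) (q : nat -> nat -> nat -> I) n :
    (forall i j k, i != j -> j != k -> i != k ->
      (orient (P i) (P j) (P k) != 0)%R) ->
    uniq [:: b 0; b 1; b 2; b 3; b 4] ->
    (forall i j, i < j < 5 -> q i j 0 = b i /\ q i j n.+1 = b j) ->
    (forall i j a c, i < j < 5 -> a <= n.+1 -> c <= n.+1 ->
       q i j a = q i j c -> a = c) ->
    (forall i j k l a c, i < j < 5 -> k < l < 5 -> uniq [:: i; j; k; l] ->
       a <= n.+1 -> c <= n.+1 -> q i j a != q k l c) ->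
  exists i j k l, [/\ i < j < 5, k < l < 5, uniq [:: i; j; k; l] &
    path_crossing P n.+1 (q i j) (q k l)].
Proof.
move=> generic b_uniq q_ends q_inj q_disj; apply: contrapT => no_cross.
pose w i j k := fan P n.+1 (q i j) (b k).
have E i j k l : i < j < 5 -> k < l < 5 -> uniq [:: i; j; k; l] ->
    crossing P (b i) (b j) (b k) (b l) = (w i j k (+) w i j l (+) (w k l i (+) w k l j)).
  move=> ij kl ijkl; have [ij0 ij1] := q_ends i j ij; have [kl0 kl1] := q_ends k l kl.
  have : path_crossing P n.+1 (q i j) (q k l) = false.
    by apply/negP => H; apply: no_cross; exists i, j, k, l.
  rewrite (path_crossingE generic); first last.
  - by move=> a c; apply: q_disj.
  - by move=> a c; apply: q_inj.
  - by move=> a c; apply: q_inj.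
  rewrite ij0 ij1 kl0 kl1 -/(w i j k) -/(w i j l) -/(w k l i) -/(w k l j).
  by move: (crossing _ _ _ _ _) (w i j k) (w i j l) (w k l i) (w k l j) => [] [] [] [] [].
have [_] := five_points generic b_uniq.
rewrite (E 0 1 2 3 isT isT isT).
rewrite (E 0 2 1 3 isT isT isT).
rewrite (E 0 3 1 2 isT isT isT).
rewrite (E 0 1 2 4 isT isT isT).
rewrite (E 0 2 1 4 isT isT isT).
rewrite (E 0 4 1 2 isT isT isT).
rewrite (E 0 1 3 4 isT isT isT).
rewrite (E 0 3 1 4 isT isT isT).
rewrite (E 0 4 1 3 isT isT isT).
rewrite (E 0 2 3 4 isT isT isT).
rewrite (E 0 3 2 4 isT isT isT).
rewrite (E 0 4 2 3 isT isT isT).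
rewrite (E 1 2 3 4 isT isT isT).
rewrite (E 1 3 2 4 isT isT isT).
rewrite (E 1 4 2 3 isT isT isT).
by rewrite addb_disjoint_edges.
Qed.

(** * Crossing segments are close; perturbation to general position *)

Section GeneralPosition.
Variable R : realFieldType.
Local Open Scope ring_scope.

Lemma opposite_signs_norm_le (p q : R) : (0 < p) != (0 < q) -> q != 0 ->
  `|q| <= `|p - q|.
Proof.
move=> pq q0; case: (ltrP 0 p) pq => hp; case: (ltrP 0 q) => // hq _.
  by rewrite (ler0_norm hq) ger0_norm; lra.
by rewrite (gtr0_norm hq) ler0_norm; lra.
Qed.

(** In the application [p], [q], [r], [s] are the orientations of [bcd], [acd], [abc], [abd]. The
    segments meet at parameter [- q / (p - q)] on [ab] and [r / (p - q)] on [cd]; both are at most 1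
    in absolute value, so [a] and [c] are each within [e] of the meeting point. *)
Lemma crossing_near_coordinate (p q r s xa xb xc xd e : R) :
    (0 < p) != (0 < q) -> (0 < r) != (0 < s) -> q != 0 -> r != 0 ->
    p - q = r - s -> (p - q) * (xa - xc) = q * (xb - xa) + r * (xd - xc) ->
    `|xa - xb| <= e -> `|xc - xd| <= e ->
  `|xa - xc| <= e *+ 2.
Proof.
move=> pq rs q0 r0 D E ab cd.
have Dq : `|q| <= `|p - q| by apply: opposite_signs_norm_le.
have Dr : `|r| <= `|p - q|.
  by rewrite D (distrC r s); apply: opposite_signs_norm_le; rewrite // eq_sym.
have D0 : 0 < `|p - q| by apply: lt_le_trans Dq; rewrite normr_gt0.
rewrite -(ler_pM2l D0) -normrM E; apply: le_trans (ler_normD _ _) _.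
rewrite !normrM mulrnAr mulr2n distrC in ab *; rewrite distrC in cd.
by apply: lerD; apply: ler_pM.
Qed.

Lemma crossing_near (I : eqType) (P : I -> R * R) (a b c d : I) (e : R) :
    crossing P a b c d ->
    orient (P a) (P c) (P d) != 0 -> orient (P a) (P b) (P c) != 0 ->
    `|(P a).1 - (P b).1| <= e -> `|(P a).2 - (P b).2| <= e ->
    `|(P c).1 - (P d).1| <= e -> `|(P c).2 - (P d).2| <= e ->
  `|(P a).1 - (P c).1| <= e *+ 2 /\ `|(P a).2 - (P c).2| <= e *+ 2.
Proof.
rewrite /crossing /ccw (orient_rot (P a) (P c) (P d)) (orient_rot (P b) (P c) (P d)).
move=> /andP[rs]; rewrite eq_sym => pq q0 r0 ab1 ab2 cd1 cd2.
have D : orient (P b) (P c) (P d) - orient (P a) (P c) (P d) =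
         orient (P a) (P b) (P c) - orient (P a) (P b) (P d).
  by rewrite /orient; ring.
split; [apply: (crossing_near_coordinate pq rs q0 r0 D _ ab1 cd1)
       |apply: (crossing_near_coordinate pq rs q0 r0 D _ ab2 cd2)];
by rewrite /orient; ring.
Qed.

Lemma poly_nonroot_small (p : {poly R}) (e : R) : p != 0 -> 0 < e ->
  exists2 s, 0 < s <= e & p.[s] != 0.
Proof.
move=> p0 e0; pose x m : R := e / m.+1%:R.
have x_inj : injective x.
  move=> m n /(mulfI (lt0r_neq0 e0))/invr_inj/eqP.
  by rewrite eqr_nat => /eqP[].
have [m le_m xm] : exists2 m, (m <= size p)%N & ~~ root p (x m).
  apply: contrapT => no.
  have := max_poly_roots (rs := [seq x m | m <- iota 0 (size p).+1]) p0.
  rewrite size_map size_iota map_inj_uniq ?iota_uniq // => H.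
  have : all (root p) [seq x m | m <- iota 0 (size p).+1].
    apply/allP => _ /mapP[m m_le ->]; apply: contrapT => /negP xm; apply: no.
    by exists m => //; move: m_le; rewrite mem_iota.
  by move=> /H/(_ isT); rewrite ltnNge leqnSn.
exists (x m) => //; rewrite /x divr_gt0 ?ltr0n //= ler_pdivrMr ?ltr0n //.
by rewrite (ler_peMr (ltW e0)) ?ler1n.
Qed.

Lemma general_position (I : finType) (P : I -> R * R) (e : R) : 0 < e ->
  exists P' : I -> R * R,
    (forall i, `|(P' i).1 - (P i).1| <= e /\ `|(P' i).2 - (P i).2| <= e) /\
    (forall i j k, i != j -> j != k -> i != k -> orient (P' i) (P' j) (P' k) != 0).
Proof.
move=> e0; pose t (i : I) : R := (enum_rank i)%:R.
have t_inj (i j : I) : i != j -> t i - t j != 0.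
  by move=> ij; rewrite subr_eq0 eqr_nat (inj_eq val_inj) (inj_eq enum_rank_inj).
pose N : R := #|I|%:R + 1.
have N1 : 1 <= N by rewrite /N lerDr ler0n.
have tN i : 0 <= t i <= N.
  by rewrite ler0n /= /N ltW // ltr_pwDr // ler_nat ltnW // ltn_ord.
(* Moving point number [t] by [s (t, t^2)] makes each orientation a quadratic
   polynomial in [s] whose leading coefficient is a Vandermonde determinant. *)
pose Q s i : R * R := ((P i).1 + s * t i, (P i).2 + s * t i ^+ 2).
(* [D1] is the sum of the linear and the quadratic coefficient, read off at [s = 1]. *)
pose D1 i j k := orient (Q 1 i) (Q 1 j) (Q 1 k) - orient (P i) (P j) (P k).
pose D2 i j k := (t j - t i) * (t k - t i) * (t k - t j).
pose D i j k : {poly R} := (orient (P i) (P j) (P k))%:P +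
  (D1 i j k - D2 i j k)%:P * 'X + (D2 i j k)%:P * 'X^2.
have DE s i j k : (D i j k).[s] = orient (Q s i) (Q s j) (Q s k).
  by rewrite /D !hornerE /D1 /D2 /Q /orient /=; ring.
pose cond (x : I * I * I) := [&& x.1.1 != x.1.2, x.1.2 != x.2 & x.1.1 != x.2].
(* One [s] that is not a root of the product serves all triples at once. *)
pose p := \prod_(x | cond x) D x.1.1 x.1.2 x.2.
have p0 : p != 0.
  apply/prodf_neq0 => -[[i j] k] /and3P[/= ij jk ik].
  apply/eqP => /(congr1 (fun f : {poly R} => f`_2)).
  rewrite /D coef0 !coefD coefC coefCM coefX coefCM coefXn /= mulr0 mulr1 !add0r.
  apply/eqP; rewrite /D2 !mulf_neq0 ?t_inj // eq_sym //.
(* Both [t i] and [t i ^+ 2] are at most [N ^+ 2], so this bound on [s] keeps the displacement below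
   [e]. *)
have [|s /andP[s0 sN] ps] := poly_nonroot_small (e := e / N ^+ 2) p0.
  by rewrite divr_gt0 // exprn_gt0 //; lra.
exists (Q s); split=> [i|i j k ij jk ik].
  have N2 : 0 < N ^+ 2 by rewrite exprn_gt0 //; lra.
  have {}sN : s * N ^+ 2 <= e by rewrite -ler_pdivlMr.
  have [t0 tN'] := andP (tN i).
  rewrite /Q /= !(addrC (_ i).1) !(addrC (_ i).2) !addrK !ger0_norm ?mulr_ge0 ?sqr_ge0 ?(ltW s0) //.
  split; apply: le_trans sN; rewrite ler_pM2l //; nra.
rewrite -DE; apply: contraNneq ps => E.
by rewrite /p horner_prod (bigD1 (i, j, k)) /= ?E ?mul0r // /cond /= ij jk ik.
Qed.

End GeneralPosition.

(** * Plane drawings *)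

Section Arcs.
Variable R : realType.
Local Open Scope ring_scope.
Implicit Types (g h : R -> R * R) (e d s t : R).

(** The supremum of the [b] with [Pr 0 b] is itself reached, and the local hypothesis there would
    push it further if it were below 1. This stands in for compactness of the interval below. *)
Lemma unit_interval_induction (Pr : R -> R -> Prop) :
    (forall a b c, 0 <= a -> a <= b -> b <= c -> c <= 1 ->
       Pr a b -> Pr b c -> Pr a c) ->
    (forall t, 0 <= t <= 1 -> exists2 d, 0 < d &
       forall a b, 0 <= a -> a <= t -> t <= b -> b <= 1 ->
         t - d < a -> b < t + d -> Pr a b) ->
  Pr 0 1.
Proof.
move=> add loc; pose S : set R := [set x | 0 <= x <= 1 /\ Pr 0 x]%classic.
have S0 : S 0.
  have [|d d0 dP] := loc 0; first by rewrite lexx ler01.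
  by split; [rewrite lexx ler01|apply: dP; rewrite ?lexx ?ler01 //; lra].
have supS : has_sup S.
  by split; [exists 0|exists 1 => x [/andP[]]].
have ub x : S x -> x <= sup S by apply: sup_upper_bound.
have s01 : 0 <= sup S <= 1.
  by rewrite ub //= ge_sup //; [exists 0|move=> x [/andP[]]].
have [d d0 dP] := loc _ s01; have [s_ge0 s_le1] := andP s01.
have [x [/andP[x0 x1] Px] lt_x] := sup_adherent d0 supS.
have x_le : x <= sup S by apply: ub; split => //; rewrite x0.
have Ps : Pr 0 (sup S).
  by apply: (add 0 x) => //; apply: dP => //; lra.
have [->|ne] := eqVneq 1 (sup S); first by [].
pose y := Num.min 1 (sup S + d / 2).
have lt_y : sup S < y by rewrite lt_min lt_neqAle eq_sym ne s_le1 /=; lra.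
have y_le1 : y <= 1 by rewrite ge_min lexx.
have y_lt : y < sup S + d by rewrite gt_min orbC; apply/orP; left; lra.
have : y <= sup S.
  apply: ub; split; first by apply/andP; split=> //; lra.
  by apply: (add 0 (sup S)) => //; [lra|apply: dP => //; lra].
lra.
Qed.

Lemma arc_continuous_at g t e : {within `[0, 1], continuous g}%classic ->
    0 <= t <= 1 -> 0 < e ->
  exists2 d, 0 < d & forall s, 0 <= s <= 1 -> `|t - s| < d -> `|g t - g s| < e.
Proof.
move=> /subspace_continuousP gc t01 e0.
have /cvgrPdist_lt/(_ e e0) : (g x @[x --> within `[0, 1] (nbhs t)] --> g t)%classic.
  by apply: gc; rewrite /= in_itv.
case/nbhs_normP => d d0 dP; exists d => // s s01 ts.
by apply: dP => //=; rewrite in_itv.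
Qed.

Lemma locally_bounded_away (Q : R -> R -> Prop) :
    (forall d d' s, d <= d' -> Q d' s -> Q d s) ->
    (forall t, 0 <= t <= 1 -> exists2 r, 0 < r & exists2 d, 0 < d &
       forall s, 0 <= s <= 1 -> `|t - s| < r -> Q d s) ->
  exists2 d, 0 < d & forall s, 0 <= s <= 1 -> Q d s.
Proof.
move=> Qle loc.
apply: (unit_interval_induction (Pr := fun a b => exists2 d, 0 < d &
  forall s, a <= s <= b -> Q d s)).
  move=> a b c _ _ _ _ [d d0 dP] [d' d0' dP'].
  exists (Num.min d d') => [|s /andP[as_ sc]]; first by rewrite lt_min d0.
  case: (lerP s b) => sb.
    by apply: (Qle _ d); [rewrite ge_min lexx|apply: dP; rewrite as_].
  by apply: (Qle _ d'); [rewrite ge_min lexx orbT|apply: dP'; rewrite sc ltW].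
move=> t t01; have [r r0 [d d0 dP]] := loc t t01.
exists r => // a b a0 at_ tb b1 da db; exists d => // s /andP[as_ sb].
by apply: dP; [apply/andP; split|rewrite ltr_norml; apply/andP; split]; lra.
Qed.

(** Compactness is used twice: along [h] for a fixed point of [g], then along [g]. *)
Lemma arcs_apart g h :
    {within `[0, 1], continuous g}%classic -> {within `[0, 1], continuous h}%classic ->
    (forall s t, 0 <= s <= 1 -> 0 <= t <= 1 -> g s <> h t) ->
  exists2 d, 0 < d & forall s t, 0 <= s <= 1 -> 0 <= t <= 1 -> d <= `|g s - h t|.
Proof.
move=> gc hc gh.
have n0 s t : 0 <= s <= 1 -> 0 <= t <= 1 -> 0 < `|g s - h t|.
  by move=> s01 t01; rewrite normr_gt0 subr_eq0; apply/eqP/gh.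
have half x : 0 < x -> 0 < x / 2 :> R by move=> x0; rewrite divr_gt0.
have point t : 0 <= t <= 1 -> exists2 d, 0 < d &
    forall s, 0 <= s <= 1 -> d <= `|g t - h s|.
  move=> t01; apply: (@locally_bounded_away (fun d s => d <= `|g t - h s|)).
    by move=> d d' s; apply: le_trans.
  move=> u u01; have [d d0 dP] := arc_continuous_at hc u01 (half _ (n0 t u t01 u01)).
  exists d => //; exists (`|g t - h u| / 2) => [|s s01 us]; first exact/half/n0.
  have := dP s s01 us; have := ler_distD (h s) (g t) (h u); rewrite (distrC (h s)); lra.
suff [d d0 dP] : exists2 d, 0 < d & forall s, 0 <= s <= 1 ->
    forall t, 0 <= t <= 1 -> d <= `|g s - h t|.
  by exists d => // s t s01 t01; apply: dP.
apply: (@locally_bounded_away (fun d s => forall t, 0 <= t <= 1 -> d <= `|g s - h t|)).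
  by move=> d d' s le H t t01; apply: le_trans (H t t01).
move=> u u01; have [D D0 DP] := point u u01.
have [d d0 dP] := arc_continuous_at gc u01 (half _ D0).
exists d => //; exists (D / 2) => [|s s01 us t t01]; first exact: half.
have := DP t t01; have := dP s s01 us; have := ler_distD (g s) (g u) (h t); lra.
Qed.

Lemma arc_chain g e : {within `[0, 1], continuous g}%classic -> 0 < e ->
  exists ts : seq R, [/\ path (fun s t => `|g s - g t| <= e) 0 ts, last 0 ts = 1 &
    forall t, t \in ts -> 0 <= t <= 1].
Proof.
move=> gc e0.
apply: (unit_interval_induction (Pr := fun a b => exists ts : seq R,
  [/\ path (fun s t => `|g s - g t| <= e) a ts, last a ts = b &
    forall t, t \in ts -> 0 <= t <= 1])).
  move=> a b c _ _ _ _ [ts [p1 l1 t1]] [us [p2 l2 t2]]; exists (ts ++ us).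
  rewrite cat_path last_cat l1 p1 p2; split=> // t.
  by rewrite mem_cat => /orP[/t1|/t2].
move=> t t01; have [d d0 dP] := arc_continuous_at gc t01 (divr_gt0 e0 (ltr0Sn R 1)).
exists d => // a b a0 at_ tb b1 da db; exists [:: b]; rewrite /= andbT; split=> //.
  have ga := dP a; have gb := dP b; have := ler_distD (g t) (g a) (g b).
  rewrite (distrC (g a) (g t)).
  have : `|g t - g a| < e / 2.
    by apply: ga; [apply/andP; split; lra|rewrite ger0_norm; lra].
  have : `|g t - g b| < e / 2.
    by apply: gb; [apply/andP; split; lra|rewrite ler0_norm; lra].
  lra.
by move=> x; rewrite inE => /eqP->; rewrite b1 andbT; lra.
Qed.

End Arcs.

Section PlaneDrawings.
Variables (R : realType) (G : sgraph) (pt : G -> R * R) (arc : G -> G -> R -> R * R).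
Hypothesis drawing : is_plane_drawing pt arc.
Local Open Scope ring_scope.

Definition on_walk (s : seq G) (z : R * R) := exists x y t,
  [/\ edge x y, x \in s, y \in s & 0 <= t <= 1 /\ z = arc x y t].

Lemma arc_ends x y : edge x y -> arc x y 0 = pt x /\ arc x y 1 = pt y.
Proof. by case: drawing => _ H _ _ /H[]. Qed.

Lemma arc_vertex x y z t : edge x y -> x <> z -> y <> z -> 0 <= t <= 1 ->
  arc x y t <> pt z.
Proof.
move=> xy xz yz /andP[t0 t1]; have [pt_inj _ arc_pt _] := drawing.
have [a0 a1] := arc_ends xy.
case: (ltrgtP 0 t) t0 => // [t_gt0|<-] _; last by rewrite a0 => /pt_inj.
case: (ltrgtP t 1) t1 => // [t_lt1|->] _; last by rewrite a1 => /pt_inj.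
by apply: arc_pt => //; rewrite in_itv /= t_gt0.
Qed.

Lemma disjoint_arcs x y u v s t : edge x y -> edge u v ->
    ~~ has (mem [:: u; v]) [:: x; y] -> 0 <= s <= 1 -> 0 <= t <= 1 ->
  arc x y s <> arc u v t.
Proof.
move=> xy uv; rewrite /= !inE !negb_or andbT.
move=> /andP[/andP[/eqP xu /eqP xv] /andP[/eqP yu /eqP yv]] s01 t01.
have [a0 a1] := arc_ends uv; have [b0 b1] := arc_ends xy.
have [t0 t1] := andP t01; have [s0 s1] := andP s01.
case: (ltrgtP 0 t) t0 => // [t_gt0|<-] _; last by rewrite a0; apply: arc_vertex.
case: (ltrgtP t 1) t1 => // [t_lt1|->] _; last by rewrite a1; apply: arc_vertex.
case: (ltrgtP 0 s) s0 => // [s_gt0|<-] _.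
  case: (ltrgtP s 1) s1 => // [s_lt1|->] _.
    case: drawing => _ _ _; apply; rewrite ?in_itv /= ?s_gt0 ?t_gt0 // => -[E _].
      by apply: xu.
    by apply: yu.
  by rewrite b1; apply/nesym; apply: arc_vertex => //; apply/nesym.
by rewrite b0; apply/nesym; apply: arc_vertex => //; apply/nesym.
Qed.

Lemma finite_common_bound (T : finType) (Q : T -> R -> Prop) :
    (forall x d d', d <= d' -> Q x d' -> Q x d) ->
    (forall x, exists2 d, 0 < d & Q x d) ->
  exists2 d, 0 < d & forall x, Q x d.
Proof.
move=> Qle Qex.
suff [d d0 dP] : exists2 d, 0 < d & forall x, x \in enum T -> Q x d.
  by exists d => // x; apply: dP; rewrite mem_enum.
elim: (enum T) => [|x s [d d0 dP]]; first by exists 1.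
have [d' d0' dP'] := Qex x.
exists (Num.min d d') => [|y]; first by rewrite lt_min d0.
rewrite inE => /orP[/eqP->|/dP]; first by apply: Qle dP'; rewrite ge_min lexx orbT.
by apply: Qle; rewrite ge_min lexx.
Qed.

Lemma disjoint_arcs_apart : exists2 d, 0 < d & forall x y u v s t,
  edge x y -> edge u v -> ~~ has (mem [:: u; v]) [:: x; y] ->
  0 <= s <= 1 -> 0 <= t <= 1 -> d <= `|arc x y s - arc u v t|.
Proof.
have [|[[[x y] u] v]|d d0 dP] := @finite_common_bound (G * G * G * G)%type
  (fun p d => let: (x, y, u, v) := p in forall s t,
    edge x y -> edge u v -> ~~ has (mem [:: u; v]) [:: x; y] ->
    0 <= s <= 1 -> 0 <= t <= 1 -> d <= `|arc x y s - arc u v t|).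
- move=> [[[x y] u] v] d d' le H s t xy uv xyuv s01 t01.
  exact: le_trans le (H s t xy uv xyuv s01 t01).
- have [H|H] := pselect [/\ edge x y, edge u v & ~~ has (mem [:: u; v]) [:: x; y]].
    have [xy uv xyuv] := H; have [_ cont _ _] := drawing.
    have [c1 _ _ _ _] := cont x y xy; have [c2 _ _ _ _] := cont u v uv.
    have [|d d0 dP] := arcs_apart c1 c2.
      by move=> s t s01 t01; apply: disjoint_arcs.
    by exists d => // s t _ _ _; apply: dP.
  by exists 1 => // s t xy uv xyuv; case: H.
- by exists d => // x y u v; apply: (dP (x, y, u, v)).
Qed.

Lemma walk_chain (e : R) x (p : seq G) : 0 < e -> path edge x p ->
  exists zs : seq (R * R), [/\ path (fun z w => `|z - w| <= e) (pt x) zs,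
    last (pt x) zs = pt (last x p) & forall z, z \in zs -> on_walk (x :: p) z].
Proof.
move=> e0; elim: p x => [|y p IHp] x /=; first by exists [::].
case/andP=> xy /IHp[zs [zsP zs_last zs_on]].
have [_ cont _ _] := drawing; have [c _ a0 a1 _] := cont x y xy.
have [ts [tsP ts_last ts01]] := arc_chain c e0.
exists (map (arc x y) ts ++ zs); rewrite cat_path last_cat -a0 last_map ts_last a1.
rewrite path_map zs_last; split=> //; first by rewrite tsP.
move=> z; rewrite mem_cat => /orP[/mapP[t /ts01 t01 ->]|/zs_on].
  by exists x, y, t; rewrite !inE !eqxx orbT.
case=> u [v [t [uv us vs tP]]]; exists u, v, t.
by split=> //; rewrite in_cons ?us ?vs orbT.
Qed.

(** The polygon rests at its end point from [N] on, so that several polygons can be given the same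
    number of segments. *)
Lemma walk_polygon (e : R) x (p : seq G) : 0 < e -> path edge x p -> p != [::] ->
  exists fN : (nat -> R * R) * nat, let: (f, N) := fN in
    [/\ f 0%N = pt x, forall m, (N <= m)%N -> f m = pt (last x p),
        forall m, `|f m - f m.+1| <= e & forall m, on_walk (x :: p) (f m)].
Proof.
move=> e0 xp p0; have [zs [zsP zs_last zs_on]] := walk_chain e0 xp.
set z1 := pt (last x p) in zs_last *.
exists (fun m => nth z1 (pt x :: zs) m, size zs); split=> //.
- move=> m le; case: (ltngtP (size zs) m) le => // [lt|<-] _.
    by rewrite nth_default.
  by rewrite nth_last /= zs_last.
- move=> m; case: (ltnP m (size zs)) => [lt|le]; first exact: (pathP z1 zsP).
  rewrite [nth _ _ m.+1]nth_default //; case: (ltngtP (size zs) m) le => // [lt|<-] _.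
    by rewrite nth_default // subrr normr0 ltW.
  by rewrite nth_last /= zs_last subrr normr0 ltW.
have on0 : on_walk (x :: p) (pt x).
  case: p xp p0 {zs_on zs_last z1} => // y p /andP[xy _] _.
  exists x, y, 0; rewrite !inE !eqxx orbT lexx ler01; split=> //; split=> //.
  by have [] := arc_ends xy.
have on1 : on_walk (x :: p) z1.
  case: (lastP zs) zs_last zs_on => [/= <- //|s z]; rewrite last_rcons => -> H.
  by apply: H; rewrite mem_rcons inE eqxx.
case=> [|m] //=; have [lt|le] := ltnP m (size zs); first by apply/zs_on/mem_nth.
by rewrite nth_default.
Qed.

Lemma on_disjoint_walks_apart d s1 s2 z w :
    (forall x y u v s t,
      edge x y -> edge u v -> ~~ has (mem [:: u; v]) [:: x; y] ->
      0 <= s <= 1 -> 0 <= t <= 1 -> d <= `|arc x y s - arc u v t|) ->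
    ~~ has (mem s2) s1 -> on_walk s1 z -> on_walk s2 w -> d <= `|z - w|.
Proof.
move=> apart /hasPn s12 [x [y [s [xy xs ys [s01 ->]]]]] [u [v [t [uv us vs [t01 ->]]]]].
apply: apart => //; have neq a b : a \in s1 -> b \in s2 -> a != b.
  by move=> as1 bs2; apply/eqP => E; move: (s12 _ as1); rewrite /= E bs2.
by rewrite /= !inE !negb_or !neq.
Qed.

End PlaneDrawings.

Lemma big_addb_ex n (F : 'I_n -> bool) : \big[addb/false]_i F i -> exists i, F i.
Proof.
move=> H; apply/existsP; apply: contraTT H => /existsPn nF.
by rewrite big1 // => i _; apply/negbTE/nF.
Qed.

(** Only walks for disjoint edges of [K_5] must be disjoint, since only their crossings are counted.
    Walks with a common branch vertex may overlap, which lets walks encode a minor without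
    contractions. *)
Lemma planar_no_K5 (R : realType) (G : sgraph) (b : nat -> G)
    (p : nat -> nat -> seq G) : planar R G ->
    (forall i j, i < j < 5 -> [/\ path edge (b i) (p i j), last (b i) (p i j) = b j
       & p i j != [::]]) ->
    (forall i j k l, i < j < 5 -> k < l < 5 -> uniq [:: i; j; k; l] ->
       ~~ has (mem (b k :: p k l)) (b i :: p i j)) ->
  False.
Proof.
case=> pt [arc drawing] pP p_disj.
have [d d0 apart] := disjoint_arcs_apart drawing.
(* Moving points by [e] leaves segments of extent at most [3e], so crossing ones start within [6e]
   of each other, and the original points are within [8e < d]. *)
pose e : R := (d / 10%:R)%R.
have e0 : (0 < e)%R by rewrite divr_gt0.
have poly (ij : nat * nat) : exists fN : (nat -> R * R) * nat,
    ij.1 < ij.2 < 5 ->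
    [/\ fN.1 0 = pt (b ij.1), forall m, fN.2 <= m -> fN.1 m = pt (b ij.2),
        forall m, (`|fN.1 m - fN.1 m.+1| <= e)%R &
        forall m, on_walk arc (b ij.1 :: p ij.1 ij.2) (fN.1 m)].
  case: ij => i j /=; have [ij|] := boolP (i < j < 5); last first.
    by exists (fun=> 0%R, 0) => /negP.
  have [pe pl p0] := pP i j ij.
  have [[f N] fP] := walk_polygon drawing e0 pe p0.
  by exists (f, N); rewrite -pl.
have [F FP] := choice poly.
pose n := \max_(i < 5) \max_(j < 5) (F (i : nat, j : nat)).2.
have nP i j : i < 5 -> j < 5 -> (F (i, j)).2 <= n.
  move=> i5 j5; apply: leq_trans (leq_bigmax (Ordinal i5)).
  exact: leq_trans (leq_bigmax (Ordinal j5)).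
(* A branch vertex has one index shared by all its polygons. Interior points have indices of their
   own, so points that coincide can be moved apart. *)
pose I : finType := ('I_5 + 'I_5 * 'I_5 * 'I_n.+1)%type.
pose o i : 'I_5 := inord i.
pose q i j a : I := if a == 0 then inl (o i) else if a == n.+1 then inl (o j)
                    else inr (o i, o j, inord a).
pose P0 (x : I) : R * R := match x with
  | inl i => pt (b i) | inr (i, j, a) => (F (i : nat, j : nat)).1 a end.
have oK i : i < 5 -> o i = i :> nat by move=> i5; rewrite inordK.
have o_inj i j : i < 5 -> j < 5 -> o i = o j -> i = j.
  by move=> i5 j5 /(congr1 val) /=; rewrite !oK.
have P0q i j a : i < j < 5 -> a <= n.+1 -> P0 (q i j a) = (F (i, j)).1 a.
  move=> ij le; have [j5 i5] : j < 5 /\ i < 5 by lia.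
  have [f0 f1 _ _] := FP (i, j) ij; rewrite /q.
  case: eqP => [->|a0]; first by rewrite /= oK.
  case: eqP => [->|an]; first by rewrite /= oK // f1 // ltnW // ltnS nP.
  by rewrite /= !oK // inordK //; lia.
have [P [PP generic]] := general_position P0 e0.
have q_inj i j a c : i < j < 5 -> a <= n.+1 -> c <= n.+1 -> q i j a = q i j c -> a = c.
  move=> ij la lc; have [j5 i5] : j < 5 /\ i < 5 by lia.
  have ne : o i <> o j by move/(o_inj _ _ i5 j5); lia.
  rewrite /q; case: (a =P 0) => a0; case: (c =P 0) => c0;
  case: (a =P n.+1) => an; case: (c =P n.+1) => cn //; try lia;
  try by [case|case=> /esym].
  by case=> /(congr1 val); rewrite /= !inordK //; lia.
have q_disj i j k l a c : i < j < 5 -> k < l < 5 -> uniq [:: i; j; k; l] ->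
    a <= n.+1 -> c <= n.+1 -> q i j a != q k l c.
  move=> ij kl; rewrite /= !inE !negb_or !andbT.
  move=> /and3P[/and3P[n1 n2 n3] /andP[n4 n5] n6] la lc.
  have lt5 : [/\ i < 5, j < 5, k < 5 & l < 5] by split; lia.
  case: lt5 => i5 j5 k5 l5.
  have ne x y : x < 5 -> y < 5 -> x != y -> o x <> o y.
    by move=> x5 y5 /eqP xy /(o_inj _ _ x5 y5).
  have := (ne i k i5 k5 n2, ne i l i5 l5 n3, ne j k j5 k5 n4, ne j l j5 l5 n5).
  move=> [[[ik il] jk] jl]; apply/eqP; rewrite /q.
  by case: (a =P 0) => _; case: (c =P 0) => _; case: (a =P n.+1) => _;
    case: (c =P n.+1) => _ // -[].
have b_uniq : uniq [:: inl (o 0); inl (o 1); inl (o 2); inl (o 3); inl (o 4) : I].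
  have ne i j : i < 5 -> j < 5 -> i != j -> ((inl (o i) : I) == inl (o j)) = false.
    by move=> i5 j5 ij; apply/eqP => -[/(o_inj _ _ i5 j5)/eqP]; apply/negP.
  by rewrite /= !inE !ne.
have [|i [j [k [l [ij kl ijkl]]]]] :=
  @K5_paths_cross _ I P (fun i => inl (o i)) q n generic b_uniq _ q_inj q_disj.
  by move=> i j _; rewrite /q /= eqxx.
rewrite /path_crossing => /big_addb_ex[c /big_addb_ex[a cross]].
have lt_a := ltn_ord a; have lt_c := ltn_ord c.
have bound z w m : z < w < 5 -> m < n.+1 ->
    (`|(P (q z w m)).1 - (P (q z w m.+1)).1| <= e *+ 3 /\
     `|(P (q z w m)).2 - (P (q z w m.+1)).2| <= e *+ 3)%R.
  move=> zw lt; have [a1 a2] := PP (q z w m); have [b1 b2] := PP (q z w m.+1).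
  have [_ _ cl _] := FP (z, w) zw; have := cl m.
  rewrite -(P0q z w m zw (ltnW lt)) -(P0q z w m.+1 zw lt) prod_normE ge_max => /andP[c1 c2].
  move: a1 a2 b1 b2 c1 c2; rewrite !ler_norml !mulrSr mulr0n add0r /=.
  by move=> /andP[? ?] /andP[? ?] /andP[? ?] /andP[? ?] /andP[? ?] /andP[? ?];
    split; apply/andP; split; lra.
have neq z w x : z < w < 5 -> x < n.+1 -> q z w x != q z w x.+1.
  move=> zw lt; apply/eqP => /(q_inj _ _ _ _ zw (ltnW lt) lt); lia.
have gA : (orient (P (q i j a)) (P (q k l c)) (P (q k l c.+1)) != 0)%R.
  by apply: generic; [apply: q_disj|apply: neq|apply: q_disj] => //; apply: ltnW.
have gB : (orient (P (q i j a)) (P (q i j a.+1)) (P (q k l c)) != 0)%R.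
  by apply: generic; [apply: neq|apply: q_disj|apply: q_disj] => //; apply: ltnW.
have [ab1 ab2] := bound i j a ij lt_a; have [cd1 cd2] := bound k l c kl lt_c.
have [ac1 ac2] := crossing_near cross gA gB ab1 ab2 cd1 cd2.
have [_ _ _ on1] := FP (i, j) ij; have [_ _ _ on2] := FP (k, l) kl.
have := on_disjoint_walks_apart apart (p_disj i j k l ij kl ijkl) (on1 a) (on2 c).
rewrite -(P0q i j a ij (ltnW lt_a)) -(P0q k l c kl (ltnW lt_c)) prod_normE.
have dE : d = (e *+ 10)%R by rewrite /e -[RHS]mulr_natr divfK // pnatr_eq0.
have [a1 a2] := PP (q i j a); have [c1 c2] := PP (q k l c).
rewrite dE le_max => /orP[]; apply/negP; rewrite -ltNge ltr_norml.
  move: ac1 a1 c1 e0; rewrite !ler_norml !mulrSr mulr0n add0r /=.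
  by move=> /andP[? ?] /andP[? ?] /andP[? ?] ?; apply/andP; split; lra.
move: ac2 a2 c2 e0; rewrite !ler_norml !mulrSr mulr0n add0r /=.
by move=> /andP[? ?] /andP[? ?] /andP[? ?] ?; apply/andP; split; lra.
Qed.

(** * Isometric cycles of planar median graphs *)

Lemma isocycle_nonadjacent (G : sgraph) n (c : nat -> G) i j :
    graph_connected G -> isocycle n c -> i < j < n -> 1 < j - i < n.-1 ->
  ~~ edge (c i) (c j).
Proof.
move=> conn cyc ij ji; apply/negP => /(gdist_edge conn).
have d s t := @isocycle_gdist G conn n c s t cyc; have [_ cP _] := cyc.
have [le|gt] := leqP (j - i) n./2.
  have := d i _ le; rewrite subnKC; lia.
have := d j (n - (j - i)); rewrite (_ : j + _ = i + n) ?cP; last lia.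
by rewrite gdistC //; lia.
Qed.

(** The hexagon [c'] shares [c 0], ..., [c 3] with [c], so [c 0] and [c 3] are opposite corners of
    its cube, and [c 4], ..., [c 7] join them outside it. Each of [c 2], [c' 4], [m'] lies inside
    two of the ten walks, which meet at the branch vertex [c 1], [m], [c' 5] respectively;
    contracting these three edges would give [K_5]. *)
Lemma planar_median_no_isocycle8 (R : realType) (G : sgraph) (c : nat -> G) :
  planar R G -> median_graph G -> isocycle 8 c -> False.
Proof.
move=> planarG medG cyc; have conn := proj1 medG.
have quad := median_graph_quadrangle_condition medG.
have [c' [cyc' c'c c'e]] := isocycle_shrink conn quad (isT : 0 < 3) cyc.
have [m [m' [s_uniq [m0 m2 m4] [m1 m3 m5]]]] := hexagon_Q3 medG cyc'.
have [[ce cP cd] [ce' cP' _]] := (cyc, cyc').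
have c'6 : c' 6 = c 0 by rewrite (cP' 0) c'c.
have [E0 E1 E2 E3] := And4 (c'c 0 isT) (c'c 1 isT) (c'c 2 isT) (c'c 3 isT).
rewrite {}E0 {}E1 {}E2 {}E3 in s_uniq m0 m1 m2 m3.
have e34 : edge (c 3) (c' 4) by rewrite -(c'c 3 isT).
have e50 : edge (c' 5) (c 0) by rewrite -c'6.
have e45 := ce' 4; have [d45 d56] := (c'e 1 isT, c'e 2 isT); rewrite /= in d45 d56.
have d i j : j <= 4 -> gdist (c i) (c (i + j)) = j.
  by move=> le; apply: (isocycle_gdist conn _ cyc).
have c_neq i j : i < 8 -> j < 8 -> i != j -> c i != c j.
  by move=> i8 j8; apply: contra => /eqP/(isocycle_inj conn cyc i8 j8)->.
have nadj i j : i < j < 8 -> 1 < j - i < 7 -> ~~ edge (c i) (c j).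
  exact: isocycle_nonadjacent.
have neq x i k : edge x (c i) -> ~~ edge (c k) (c i) -> x != c k.
  by move=> xi; apply: contra => /eqP <-.
have e43 : edge (c' 4) (c 3) by rewrite edge_sym.
(* [c' 4] is adjacent to [c 3] and [c 5], and [c' 5] to [c 6] and [c 0], so nonadjacency along [c]
   cannot tell them from [c 4] and [c 7]; the antipodal distance 4 does. *)
have far4 : c' 4 != c 4.
  apply/eqP => E; have := gdist_tri conn (c' 5) (c 0) (c' 4).
  rewrite (gdistC conn (c' 5) (c' 4)) (gdist_edge conn e45).
  by rewrite (gdistC conn (c 0) (c' 5)) (gdist_edge conn e50) E (d 0 4).
have far5 : c' 5 != c 7.
  apply/eqP => E; have := gdist_tri conn (c' 4) (c 3) (c' 5).
  by rewrite (gdist_edge conn e34) (gdist_edge conn e45) E (d 3 4).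
have new k : k \in [:: 4; 5; 6; 7] ->
    c k \notin [:: m; c 0; c 2; c 1; c' 4; c' 5; c 3; m'].
  rewrite !inE => /or4P[] /eqP ->; rewrite !negb_or !c_neq // ![c _ == _]eq_sym ?andbT /=.
  - rewrite (neq m 0) ?(neq (c' 5) 0) ?(neq m' 1) ?far4 //; by rewrite edge_sym nadj.
  - rewrite (neq m 0) ?(neq (c' 5) 0) ?(neq m' 1) ?edge_neq //; by rewrite edge_sym nadj.
  - rewrite (neq m 0) ?(neq (c' 4) 3) ?(neq m' 3) ?edge_neq //; by rewrite edge_sym nadj.
  - rewrite (neq m 2) ?(neq (c' 4) 3) ?(neq m' 3) ?far5 //; by rewrite edge_sym nadj.
pose s := [:: m; c 0; c 2; c 1; c' 4; c' 5; c 3; m'] ++ [:: c 4; c 5; c 6; c 7].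
have sU : uniq s.
  rewrite cat_uniq; apply/and3P; split=> //; last by rewrite /= !inE !negb_or !c_neq.
  by apply/hasPn => x /(@mapP _ _ c [:: 4; 5; 6; 7])[k k4 ->]; apply: new.
pose f i := nth m s i.
have disj K L : all (ltn^~ 12) K -> all (ltn^~ 12) L -> ~~ has (mem K) L ->
    ~~ has (mem (map f K)) (map f L).
  move=> /allP K12 /allP L12 /hasPn KL; apply/hasPn => _ /mapP[x xL ->].
  apply/negP => /mapP[y yK] /eqP; rewrite nth_uniq ?K12 ?L12 //; first last.
  - exact: K12.
  - exact: L12.
  by move=> /eqP xy; have := KL x xL; rewrite /= xy yK.
(* Indices refer to positions in [s]: the branch vertices are [c 0], [c 3], [c 1],
   [m], [c' 5], and the walk [W i j] omits its starting vertex [B i]. *)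
pose B i := nth 0 [:: 1; 6; 3; 0; 5] i.
pose W i j := nth [::] (nth [::]
  [:: [:: [::]; [:: 11; 10; 9; 8; 6]; [:: 3]; [:: 0]; [:: 5]];
      [:: [::]; [::]; [:: 2; 3]; [:: 4; 0]; [:: 7; 5]];
      [:: [::]; [::]; [::]; [:: 2; 0]; [:: 7; 5]];
      [:: [::]; [::]; [::]; [::]; [:: 4; 5]]] i) j.
have e07 : edge (c 0) (c 7) by rewrite edge_sym -(cP 0).
have ceV i : edge (c i.+1) (c i) by rewrite edge_sym.
have edgeV (x y : G) : edge x y -> edge y x by rewrite edge_sym.
apply: (@planar_no_K5 R G (fun i => f (B i)) (fun i j => map f (W i j)) planarG).
  have adj := (ce, ceV, e07, m0, edgeV _ _ m0, edgeV _ _ e50, m2, edgeV _ _ m2, e34,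
    m4, edgeV _ _ m4, m1, edgeV _ _ m1, m3, edgeV _ _ m3, m5, e45).
  case=> [|[|[|[|[|i]]]]] [|[|[|[|[|j]]]]]; rewrite ?andbF //= => _;
    by split=> //; rewrite /f /= !adj.
move=> i j k l ij kl; rewrite -!map_cons => U.
suff /and3P[] : [&& all (ltn^~ 12) (B k :: W k l), all (ltn^~ 12) (B i :: W i j) &
    ~~ has (mem (B k :: W k l)) (B i :: W i j)] by apply: disj.
have lt5 x y : x < y < 5 -> x < 5 by move=> /andP[/ltn_trans]; apply.
have [i5 k5] := (lt5 _ _ ij, lt5 _ _ kl); have [[_ j5] [_ l5]] := (andP ij, andP kl).
move: i5 j5 k5 l5 U ij kl; case: i => [|[|[|[|[|//]]]]] _; case: j => [|[|[|[|[|//]]]]] _;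
by case: k => [|[|[|[|[|//]]]]] _; case: l => [|[|[|[|[|//]]]]] _.
Qed.

Lemma isocycle_shrink_to (G : sgraph) (c : nat -> G) j k : graph_connected G ->
    quadrangle_condition G -> 0 < j <= k -> isocycle k.*2 c ->
  exists c' : nat -> G, isocycle j.*2 c'.
Proof.
move=> conn quad /andP[j_gt0]; elim: k c => [|k IHk] c; first by case: j j_gt0.
rewrite leq_eqVlt => /orP[/eqP-> cyc|le cyc]; first by exists c.
have [c' [cyc' _ _]] := isocycle_shrink conn quad (leq_trans j_gt0 le) cyc.
exact: IHk cyc'.
Qed.

Lemma planar_median_isocycle_length (R : realType) (G : sgraph) n (c : nat -> G) :
  planar R G -> median_graph G -> 3 <= n -> isocycle n c -> n = 4 \/ n = 6.
Proof.
move=> planarG medG n3 cyc; have n_even := isocycle_even medG cyc.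
have En : n = n./2.*2 by rewrite -[LHS]odd_double_half (negbTE n_even).
have [le|gt] := leqP n./2 3; first by lia.
rewrite En in cyc.
have [|c' cyc'] := isocycle_shrink_to (j := 4) (proj1 medG)
  (median_graph_quadrangle_condition medG) _ cyc; first by rewrite gt.
by case: (planar_median_no_isocycle8 planarG medG cyc').
Qed.

Theorem theorem3p5 (R : realType) (G : sgraph) (planarG : planar R G) :
  median_graph G <->
  [/\ graph_connected G,
      graph_free (complete_bipartite_graph 2 3) G,
      C6iso_Q3_inferring G &
      forall (n : nat) (C : subgraph G),
        is_cycle n C -> isometric C -> n = 4 \/ n = 6].
Proof.
split=> [medG|[conn freeK inferQ cyc46]]; last exact: median_of_conditions.
split.
- exact: (proj1 medG).
- exact: median_graph_K23_free.
- exact: median_graph_C6iso_Q3_inferring.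
- move=> n C Ccyc Ciso; have [c [cyc _ _ _]] := subgraph_isocycle Ccyc Ciso.
  exact: planar_median_isocycle_length planarG medG (proj1 Ccyc) cyc.
Qed.
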